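(* Let $\mu\in\mathcal{M}_\delta$, $\psi\in L^1(\partial_MD;h^A_m)$, and let $f:D\times\mathbb{R}\to\mathbb{R}$ be a measurable function such that $y\mapsto f(x,y)$ is continuous and non-increasing for every $x\in D$, $f(\cdot,y)\in qL^1(D;m)$ for every $y\in\mathbb{R}$ and $f(\cdot,0)\in L^1_\delta(D;m)$. Then there exists at most one solution to the problem \[ -Au=f(\cdot,u)+\mu\ \text{ in }D,\qquad u=\psi\ \text{ on }\partial_MD. \]
   Context: Let $d\ge 2$, let $m$ be Lebesgue measure on $\mathbb{R}^d$ and let $D\subset\mathbb{R}^d$ be an arbitrary bounded open set. Let $a=(a_{ij}):\mathbb{R}^d\to\mathbb{R}^d\otimes\mathbb{R}^d$ be a bounded measurable symmetric matrix-valued function such that for some $\lambda>0$, $\sum_{i,j}a_{ij}(x)\xi_i\xi_j\ge\lambda|\xi|^2$ for all $x,\xi\in\mathbb{R}^d$. Put $Au=\sum_{i,j=1}^d(a_{ij}u_{x_i})_{x_j}$. Process: $\mathbb{X}=(\{X_t\},\{P_x,x\in\mathbb{R}^d\},\{\mathcal{F}_t\})$ is the diffusion on $\mathbb{R}^d$ associated with $A$ (generator $A$, corresponding to the Dirichlet form $(a\nabla u,\nabla v)_{L^2(\mathbb{R}^d;m)}$ on $H^1(\mathbb{R}^d)$, defined for every starting point); $\tau_D=\inf\{t>0:X_t\in\mathbb{R}^d\setminus D\}$. ''q.e.'' means outside a set of zero capacity for this form. $g_D$ is the Green function for $D$ and $A$, $R^D\eta(x)=\int_Dg_D(x,y)\eta(y)\,m(dy)=E_x\int_0^{\tau_D}\eta(X_t)\,dt$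 (continuous on $D$ for $\eta\in L^\infty(D;m)$), and $\delta=R^D1=E_\cdot\tau_D$. $L^1_\delta(D;m)=L^1(D;\delta\cdot m)$. A Borel function $u$ on $D$ belongs to $qL^1(D;m)$ if $P_x(\int_0^{\tau_D}|u(X_r)|\,dr<\infty)=1$ for q.e. $x\in D$. $\mathcal{M}_\delta$ is the space of signed Borel measures $\mu$ on $D$ with $\int_D\delta\,d|\mu|<\infty$. Martin boundary: $\kappa(x,y)=g_D(x,y)\delta^{-1}(y)$, $\hat\kappa f=\int_D\kappa(x,\cdot)f(x)\,m(dx)$, $\{f_n\}$ is a (countable) dense subset of $C_0(D)$, $\varrho(x,y)=\sum_{n\ge1}2^{-n}\frac{|\hat\kappa f_n(x)-\hat\kappa f_n(y)|}{1+|\hat\kappa f_n(x)-\hat\kappa f_n(y)|}$ is a metric on $D$, $D^*$ is the completion of $D$ with respect to $\varrho$ and $\partial_MD=D^*\setminus D$. For every $x\in D$, $P_x$-a.s. the limit $X_{\tau_D-}=\lim_{t\nearrow\tau_D}X_t$ exists with respect to $\varrho$ and belongs to $\partial_MD$. Put $h^A_x(dy)=P_x(X_{\tau_D-}\in dy)$, $h^A_m(dy)=\int_Dh^A_x(dy)\,m(dx)$. For $\psi\in L^1(\partial_MD;h^A_m)$ let $\gamma_A^{-1}(\psi)(x)=E_x\psi(X_{\tau_D-})=\int_{\partial_MD}\psi\,dh^A_x$, $x\in D$ (the harmonic function with trace $\psi$). Solution: a function $u\in L^1(D;m)$ is a solution of the problem $-Au=f(\cdot,u)+\mu$ in $D$,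 $u=\psi$ on $\partial_MD$, if $f(\cdot,u)\in L^1_\delta(D;m)$ and $\int_D(u-\gamma_A^{-1}(\psi))\eta\,dm=\int_Df(\cdot,u)R^D\eta\,dm+\int_DR^D\eta\,d\mu$ for every $\eta\in L^\infty(D;m)$. *)

(* Defs.v *)
From HB Require Import structures.
From mathcomp Require Import all_boot all_order all_algebra.
From mathcomp Require Import all_classical all_reals all_analysis.
From mathcomp Require Import measurable_realfun lebesgue_Rintegral.

Set Implicit Arguments.
Unset Strict Implicit.
Unset Printing Implicit Defensive.

Import Order.TTheory GRing.Theory Num.Theory.
Import numFieldNormedType.Exports.

Local Open Scope classical_set_scope.
Local Open Scope ring_scope.

(* Pointedness is only there because [lim] and [g_sigma_algebraType] require
   it. *)
#[short(type="completePMetricType")]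
HB.structure Definition CompletePointedMetric (K : numDomainType) :=
  {T of Pointed T & Metric K T & Complete T}.

(* R^d is ['rV[R]_n.+1] with d = n.+1, with its Borel sigma-algebra (the normed
   space structure on matrices is only available for nonzero sizes). *)
HB.instance Definition _ (R : realType) (n : nat) :=
  Measurable.copy 'rV[R]_n.+1 (g_sigma_algebraType (@open 'rV[R]_n.+1)).

Notation borel T := (g_sigma_algebraType (@open T)).

Section LebesgueMeasure.
Context {R : realType} {n : nat}.

(* There is exactly one Borel measure giving every box its volume. *)
Definition is_lebesgue_measure (m : {measure set 'rV[R]_n.+1 -> \bar R}) :=
  forall a b : 'rV[R]_n.+1, (forall i, a 0 i <= b 0 i) ->
    m [set x | forall i, a 0 i < x 0 i <= b 0 i] =
    (\prod_(i < n.+1) (b 0 i - a 0 i))%:E.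

End LebesgueMeasure.

Section DirichletForm.
Context {R : realType} {n : nat}.
Variable m : {measure set 'rV[R]_n.+1 -> \bar R}.
Implicit Types (u v f : 'rV[R]_n.+1 -> R) (a : 'rV[R]_n.+1 -> 'M[R]_n.+1).

Record elliptic_coefficients a : Prop := {
  coef_measurable : forall i j, measurable_fun setT (fun x => a x i j) ;
  coef_bounded : exists M, forall x i j, `|a x i j| <= M ;
  coef_symmetric : forall x, (a x)^T = a x ;
  coef_elliptic : exists2 lambda, 0 < lambda &
    forall x (xi : 'rV[R]_n.+1),
      lambda * \sum_i xi 0 i ^+ 2 <= \sum_i \sum_j a x i j * xi 0 i * xi 0 j
}.

Definition partial (i : 'I_n.+1) u : 'rV[R]_n.+1 -> R := 'D_(delta_mx 0 i) u.

Fixpoint continuously_differentiable (k : nat) u : Prop :=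
  if k is k'.+1 then
    continuous u /\ forall i, (forall x, derivable u x (delta_mx 0 i)) /\
                              continuously_differentiable k' (partial i u)
  else continuous u.

Definition test_function u :=
  (forall k, continuously_differentiable k u) /\
  compact (closure [set x | u x != 0]).

Definition L2 u :=
  measurable_fun setT u /\ (\int[m]_x (u x ^+ 2)%:E < +oo)%E.

Definition is_weak_gradient u (g : 'rV[R]_n.+1 -> 'rV[R]_n.+1) :=
  (forall i, L2 (fun x => g x 0 i)) /\
  forall i phi, test_function phi ->
    \int[m]_x (u x * partial i phi x) = - \int[m]_x (g x 0 i * phi x).

(* The Sobolev space H^1(R^d). *)
Definition H1 u := L2 u /\ exists g, is_weak_gradient u g.

Definition weak_gradient u : 'rV[R]_n.+1 -> 'rV[R]_n.+1 :=
  xget (fun=> 0) [set g | is_weak_gradient u g].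

Definition dirichlet_form a u v : R :=
  \int[m]_x (\sum_i \sum_j
    a x i j * weak_gradient u x 0 i * weak_gradient v x 0 j).

Definition dirichlet_form_alpha a (alpha : R) u v : R :=
  dirichlet_form a u v + alpha * \int[m]_x (u x * v x).

Definition capacity_open a (U : set 'rV[R]_n.+1) : \bar R :=
  ereal_inf [set (dirichlet_form_alpha a 1 u u)%:E |
    u in [set u | H1 u /\ \forall x \ae m, U x -> 1 <= u x]].

Definition capacity a (B : set 'rV[R]_n.+1) : \bar R :=
  ereal_inf [set capacity_open a U | U in [set U | open U /\ B `<=` U]].

Definition quasi_everywhere a (D : set 'rV[R]_n.+1)
    (Q : 'rV[R]_n.+1 -> Prop) :=
  capacity a [set x | D x /\ ~ Q x] = 0%E.

End DirichletForm.

Section Diffusion.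
Context {R : realType} {n : nat} {dO : measure_display}
  {Omega : measurableType dO}.
Variables (X : R -> Omega -> 'rV[R]_n.+1) (P : R.-pker 'rV[R]_n.+1 ~> Omega)
  (F : R -> set (set Omega)).

(* Only the times t >= 0 are meaningful in [X] and [F]. Monotonicity of [F] is
   part of right continuity. *)

Record is_filtration : Prop := {
  filtration_sigma_algebra : forall t, 0 <= t -> sigma_algebra setT (F t) ;
  filtration_measurable : forall t, 0 <= t -> F t `<=` measurable ;
  filtration_right_continuous : forall t, 0 <= t ->
    F t = \bigcap_(s in [set s | t < s]) F s
}.

Definition stopping_time (sigma : Omega -> \bar R) :=
  (forall w, 0 <= sigma w)%E /\
  forall t, 0 <= t -> F t [set w | (sigma w <= t%:E)%E].

Definition stopped_sigma_algebra (sigma : Omega -> \bar R) : set (set Omega) :=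
  [set A | measurable A /\
    forall t, 0 <= t -> F t (A `&` [set w | (sigma w <= t%:E)%E])].

Definition strong_markov :=
  forall (sigma : Omega -> \bar R) A (s : R) (B : set 'rV[R]_n.+1) x,
    stopping_time sigma -> stopped_sigma_algebra sigma A -> 0 <= s ->
    measurable B ->
    let A' := A `&` [set w | (sigma w < +oo)%E] in
    P x (A' `&` [set w | B (X (fine (sigma w) + s) w)]) =
    (\int[P x]_(w in A') P (X (fine (sigma w)) w) (X s @^-1` B))%E.

Definition alpha_resolvent (alpha : R) (f : 'rV[R]_n.+1 -> R) x : R :=
  \int[P x]_w \int[lebesgue_measure]_(t in `[0, +oo[)
    (expR (- (alpha * t)) * f (X t w)).

(* A strong Markov process with continuous paths whose resolvent is the one of
   the form (a grad u, grad v) on H^1(R^d). The form only determines P_x up to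
   an exceptional set of starting points x; the strong Feller property selects
   the process defined for every x, whose transition function has a continuous
   density. The form being conservative, no cemetery point is needed. *)
Record is_diffusion (m : {measure set 'rV[R]_n.+1 -> \bar R})
    (a : 'rV[R]_n.+1 -> 'M[R]_n.+1) : Prop := {
  diffusion_filtration : is_filtration ;
  diffusion_adapted : forall t (B : set 'rV[R]_n.+1),
    0 <= t -> measurable B -> F t (X t @^-1` B) ;
  diffusion_start : forall x, P x [set w | X 0 w = x] = 1%E ;
  diffusion_continuous : forall w,
    {within [set t : R | 0 <= t], continuous (X ^~ w)} ;
  diffusion_markov : strong_markov ;
  diffusion_form : forall alpha f, 0 < alpha -> L2 m f ->
    (exists M, forall x, `|f x| <= M) ->
    H1 m (alpha_resolvent alpha f) /\
    forall v, H1 m v ->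
      dirichlet_form_alpha m a alpha (alpha_resolvent alpha f) v =
      \int[m]_x (f x * v x) ;
  diffusion_strong_feller : forall t (f : 'rV[R]_n.+1 -> R), 0 < t ->
    measurable_fun setT f -> (exists M, forall x, `|f x| <= M) ->
    continuous (fun x => \int[P x]_w f (X t w))
}.

Variable D : set 'rV[R]_n.+1.

Definition exit_time (w : Omega) : \bar R :=
  ereal_inf [set t%:E | t in [set t : R | 0 < t /\ ~ D (X t w)]].

Definition before_exit (w : Omega) : set R :=
  [set t | 0 <= t /\ (t%:E < exit_time w)%E].

Definition qL1 m (a : 'rV[R]_n.+1 -> 'M[R]_n.+1) (u : 'rV[R]_n.+1 -> R) :=
  measurable_fun D u /\
  quasi_everywhere m a D (fun x =>
    P x [set w | (\int[lebesgue_measure]_(t in before_exit w)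
                    (`|u (X t w)|)%:E < +oo)%E] = 1%E).

End Diffusion.

Section Green.
Context {R : realType} {n : nat}.
Variables (m : {measure set 'rV[R]_n.+1 -> \bar R}) (D : set 'rV[R]_n.+1).
Implicit Types (g : 'rV[R]_n.+1 -> 'rV[R]_n.+1 -> \bar R)
  (eta u phi : 'rV[R]_n.+1 -> R).

Definition bounded_borel eta :=
  measurable_fun D eta /\ exists M, forall x, D x -> `|eta x| <= M.

Definition green_operator g eta (x : 'rV[R]_n.+1) : R :=
  fine (\int[m]_(y in D) (g x y * (eta y)%:E))%E.

Definition delta g : 'rV[R]_n.+1 -> R := green_operator g (fun=> 1).

Definition L1delta g u :=
  measurable_fun D u /\ m.-integrable D (fun x => (u x * delta g x)%:E).

(* The values of g_D on the diagonal may be infinite. [green_occupation] fixes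
   g x up to null sets for every x, so that, by symmetry, none of the integrals
   below depends on the chosen version of g_D. *)
Record is_green_function {dO : measure_display} {Omega : measurableType dO}
    (X : R -> Omega -> 'rV[R]_n.+1) (P : R.-pker 'rV[R]_n.+1 ~> Omega) g
    : Prop := {
  green_measurable : measurable_fun (D `*` D)
    (fun p : 'rV[R]_n.+1 * 'rV[R]_n.+1 => g p.1 p.2) ;
  green_ge0 : forall x y, D x -> D y -> (0 <= g x y)%E ;
  green_symmetric : forall x y, D x -> D y -> g x y = g y x ;
  green_occupation : forall eta x, measurable_fun setT eta ->
    (forall y, 0 <= eta y) -> D x ->
    (\int[m]_(y in D) (g x y * (eta y)%:E) =
     \int[P x]_w \int[lebesgue_measure]_(t in before_exit X D w)
       (eta (X t w))%:E)%E ;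
  green_finite : forall x, D x -> (\int[m]_(y in D) g x y < +oo)%E ;
  green_continuous : forall eta, bounded_borel eta ->
    {within D, continuous (green_operator g eta)}
}.

(* Elements of M_delta can have infinite positive and negative variations, in
   which case they are not set functions on all Borel sets; they are given by
   their Jordan decomposition. *)
Record signed_measure := {
  pos_part : {measure set 'rV[R]_n.+1 -> \bar R} ;
  neg_part : {measure set 'rV[R]_n.+1 -> \bar R} ;
  jordan_singular : exists A, [/\ measurable A,
    pos_part (D `&` ~` A) = 0%E & neg_part (D `&` A) = 0%E]
}.

Definition Mdelta g (mu : signed_measure) :=
  (\int[pos_part mu]_(x in D) (delta g x)%:E < +oo)%E /\
  (\int[neg_part mu]_(x in D) (delta g x)%:E < +oo)%E.

Definition signed_integral (mu : signed_measure) u : R :=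
  \int[pos_part mu]_(x in D) u x - \int[neg_part mu]_(x in D) u x.

(* Continuous functions on D vanishing at the boundary. *)
Definition C0 phi :=
  {within D, continuous phi} /\
  forall e, 0 < e -> compact (D `&` [set x | e <= `|phi x|]).

Definition dense_in_C0 (phi : nat -> 'rV[R]_n.+1 -> R) :=
  (forall k, C0 (phi k)) /\
  forall f e, C0 f -> 0 < e ->
    exists k, forall x, D x -> `|f x - phi k x| <= e.

Definition kappa g (x y : 'rV[R]_n.+1) : \bar R :=
  (g x y * ((delta g y)^-1)%:E)%E.

Definition kappa_hat g phi (y : 'rV[R]_n.+1) : R :=
  fine (\int[m]_(x in D) (kappa g x y * (phi x)%:E))%E.

Definition martin_metric g (phi : nat -> 'rV[R]_n.+1 -> R)
    (x y : 'rV[R]_n.+1) : R :=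
  limn (series (fun k =>
    let r := `|kappa_hat g (phi k) x - kappa_hat g (phi k) y| in
    2^-1 ^+ k.+1 * (r / (1 + r)))).

End Green.

Section Martin.
Context {R : realType} {n : nat} {Dstar : completePMetricType R}.
Variables (D : set 'rV[R]_n.+1) (iota : 'rV[R]_n.+1 -> Dstar).

(* [iota] (only relevant on D) makes [Dstar] the completion of (D, rho). *)
Record is_completion (rho : 'rV[R]_n.+1 -> 'rV[R]_n.+1 -> R) : Prop := {
  completion_isometry : forall x y, D x -> D y ->
    mdist (iota x) (iota y) = rho x y ;
  completion_dense : closure (iota @` D) = setT
}.

Definition martin_boundary : set (borel Dstar) := ~` (iota @` D).

Context {dO : measure_display} {Omega : measurableType dO}.
Variables (X : R -> Omega -> 'rV[R]_n.+1) (P : R.-pker 'rV[R]_n.+1 ~> Omega).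

(* The path t |-> X_t in D^*, as t increases to tau_D. *)
Definition exit_filter (w : Omega) : set_system Dstar :=
  iota (X t w) @[t --> within (before_exit X D w)
                         (nbhs (fine (exit_time X D w)))].

Definition exit_position (w : Omega) : Dstar := lim (exit_filter w).

(* h_x^A; the set function P_x(X_{tau_D -} \in .). *)
Definition harmonic_measure (x : 'rV[R]_n.+1) (B : set (borel Dstar)) : \bar R :=
  P x [set w | [/\ (exit_time X D w < +oo)%E, cvg (exit_filter w) &
                   B (exit_position w)]].

Definition harmonic_measure_m (m : {measure set 'rV[R]_n.+1 -> \bar R})
    (B : set (borel Dstar)) : \bar R :=
  (\int[m]_(x in D) harmonic_measure x B)%E.

Definition L1_boundary (m : {measure set 'rV[R]_n.+1 -> \bar R})
    (psi : borel Dstar -> R) :=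
  integrable (harmonic_measure_m m) martin_boundary (EFin \o psi).

(* gamma_A^{-1}(psi) *)
Definition harmonic_extension (psi : borel Dstar -> R) (x : 'rV[R]_n.+1) : R :=
  fine (\int[harmonic_measure x]_(z in martin_boundary) (psi z)%:E)%E.

Definition is_solution (m : {measure set 'rV[R]_n.+1 -> \bar R})
    (g : 'rV[R]_n.+1 -> 'rV[R]_n.+1 -> \bar R)
    (f : 'rV[R]_n.+1 -> R -> R) (mu : signed_measure D)
    (psi : borel Dstar -> R) (u : 'rV[R]_n.+1 -> R) :=
  [/\ m.-integrable D (EFin \o u),
      L1delta m D g (fun x => f x (u x)) &
      forall eta, bounded_borel D eta ->
        \int[m]_(x in D) ((u x - harmonic_extension psi x) * eta x) =
        \int[m]_(x in D) (f x (u x) * green_operator m D g eta x) +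
        signed_integral mu (green_operator m D g eta)].

End Martin.

(* Main.v *)
Require Import Defs.
From HB Require Import structures.
From mathcomp Require Import all_boot all_order all_algebra.
From mathcomp Require Import all_classical all_reals all_analysis.
From mathcomp Require Import measurable_realfun lebesgue_Rintegral.
From mathcomp Require Import lra ring.

Set Implicit Arguments.
Unset Strict Implicit.
Unset Printing Implicit Defensive.

Import Order.TTheory GRing.Theory Num.Theory.
Import numFieldNormedType.Exports.

Local Open Scope classical_set_scope.
Local Open Scope ring_scope.

(** Let u and v be two solutions, w = u - v and h = f(., u) - f(., v). In the
    difference of the two identities the measure and the boundary datum cancel:
    the integral of w eta is the integral of h R eta for every bounded eta. By
    the symmetry of the Green function, w is a.e. the difference of the
    potentials of the positive part h+ and of the negative part h- of h. As f
    is non-increasing, w <= 0 wherever h > 0; hence the potential of h+ is at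
    most that of h- on the set where h+ > 0. By the domination principle for
    the potentials of a Markov process, it is so on all of D. Exchanging u and
    v, the two potentials coincide and w = 0 a.e. This is
    [very_weak_solution_eq0].

    The domination principle [domination] is proved for the potential kernel of
    any sub-Markovian resolvent, from the resolvent equation. It applies to the
    Green function through [potential_resolvent] and
    [killed_submarkov_resolvent]: the resolvent of the process killed outside D
    is sub-Markovian, and its value at 0 is the Green operator. The resolvent
    equation rests on the Markov property of the killed process
    [killed_semigroup_set], which follows from the Markov property at constant
    times: survival up to time t is a monotone limit of finite-dimensional
    events.

    The two identities can be subtracted because the harmonic extension of psi
    is integrable on D ([integrable_harmonic_extension]). By Tonelli the
    integral of its absolute value is at most that of |psi| against the
    harmonic measure of m, once the boundary behaviour of the process is known
    to be measurable. It is so because the Martin metric is continuous on D, the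
    convergence of a path at its exit time is a countable Cauchy condition, and
    D is a countable union of compact sets. *)

(** * Integrals over the time axis *)

Section TimeIntegrals.
Context {R : realType}.
Local Open Scope ereal_scope.
Notation leb := (@lebesgue_measure R).

Lemma lebesgue_measure_translate (t : R) (A : set (measurableTypeR R)) :
  measurable A ->
  pushforward leb (fun s : measurableTypeR R => (t + s)%R : measurableTypeR R) A
  = leb A.
Proof.
have mt : measurable_fun setT (fun s : measurableTypeR R => (t + s)%R : measurableTypeR R).
  exact: measurable_funD.
pose mtm := isMeasurableFun.Build _ _ _ _ _ mt.
pose tr : {mfun (measurableTypeR R) >-> (measurableTypeR R)} := HB.pack (fun s : measurableTypeR R => (t + s)%R : measurableTypeR R) mtm.
move=> mA; apply/esym.
apply: (@lebesgue_measure_unique R (pushforward leb tr)) => //= _ [[a b]] _ <-.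
rewrite /pushforward /=.
have -> : (fun s : R => (t + s)%R) @^-1` `]a, b] = `](a - t)%R, (b - t)%R]%classic.
  by apply/seteqP; split => x /=; rewrite !in_itv/= ltrBlDl lerBrDl.
rewrite !lebesgue_measure_itv/= !lte_fin ltrD2r.
by case: ifPn => // _; congr (_%:E); ring.
Qed.

Lemma ge0_integral_translate (t : R) (f : R -> \bar R) :
  measurable_fun [set: R] f -> (forall r, 0 <= f r) ->
  \int[leb]_s f (t + s)%R = \int[leb]_r f r.
Proof.
move=> mf f0.
have mt : measurable_fun setT (fun s : measurableTypeR R => (t + s)%R : measurableTypeR R).
  exact: measurable_funD.
transitivity (\int[pushforward leb (fun s : measurableTypeR R => (t + s)%R : measurableTypeR R)]_r f r).
  by rewrite ge0_integral_pushforward.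
by apply: eq_measure_integral => //= A mA AS; exact: lebesgue_measure_translate.
Qed.

Lemma exponential_cdf (c r : R) : (0 <= r)%R ->
  \int[leb]_t ((exponential_pdf c t)%:E * (\1_[set t | (t <= r)%R] t)%:E) =
  (1 - expR (- c * r))%:E.
Proof.
move=> r0.
transitivity (exponential_prob c `[0%R, r]).
  rewrite /exponential_prob [RHS]integral_mkcond; apply: (@eq_integral _ _ R leb setT) => t _.
  rewrite patchE indicE; have [t0|t0] := ltP t 0%R.
    rewrite lt0_exponential_pdf// mul0e.
    by case: ifP => // ; rewrite ?lt0_exponential_pdf.
  case: (leP t r) => tr.
    by rewrite !mem_set ?mule1//= in_itv/= t0 tr.
  rewrite memNset/= ?mule0; last by apply/negP; rewrite -ltNge.
  by rewrite memNset//= in_itv/= t0/=; apply/negP; rewrite -ltNge.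
move: r0; rewrite le_eqVlt => /predU1P[<-|r0].
  rewrite /exponential_prob set_itv1 integral_set1 mulr0 expR0; congr (_%:E).
  by rewrite subrr.
by rewrite exponential_prob_itv0c.
Qed.

(** The resolvent equation in the time variable: if T is exponential with rate
    c, then [\int u] splits into its part after T and its part before T. *)
Lemma exponential_split (c : R) (u : R -> \bar R) : (0 < c)%R ->
  measurable_fun [set: R] u -> (forall t, 0 <= u t) ->
  (forall t, (t < 0)%R -> u t = 0) ->
  \int[leb]_t u t =
  \int[leb]_t ((expR (- c * t))%:E * u t) +
  \int[leb]_t ((exponential_pdf c t)%:E *
    \int[leb]_s ((\1_[set s | (0 <= s)%R] s)%:E * u (t + s)%R)).
Proof.
move=> c0 mu u0 uneg.
have mle : measurable_fun [set: R * R]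
    (fun p : R * R => (\1_[set p : R * R | (p.1 <= p.2)%R] p)%:E : \bar R).
  apply/measurable_EFinP; apply: measurable_indic.
  rewrite -[X in measurable X]setTI.
  rewrite (_ : [set p | _] = (fun p : R * R => (p.1 <= p.2)%R) @^-1` [set true]).
    by apply: measurable_fun_ler => //.
  by apply/seteqP; split.
have mpdf : measurable_fun [set: R] (fun t => (exponential_pdf c t)%:E).
  by apply/measurable_EFinP; exact: measurable_exponential_pdf.
have mF2 : measurable_fun [set: R * R] (fun p : R * R =>
    (exponential_pdf c p.1)%:E *
    ((\1_[set p : R * R | (p.1 <= p.2)%R] p)%:E * u p.2)).
  apply: emeasurable_funM; first exact: (measurableT_comp mpdf measurable_fst).
  by apply: emeasurable_funM => //; exact: (measurableT_comp mu measurable_snd).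
have E2 : \int[leb]_t ((exponential_pdf c t)%:E *
    \int[leb]_s ((\1_[set s | (0 <= s)%R] s)%:E * u (t + s)%R)) =
  \int[leb]_r ((1 - expR (- c * r))%:E * u r).
  transitivity (\int[leb]_t \int[leb]_r ((exponential_pdf c t)%:E *
     ((\1_[set t | (t <= r)%R] t)%:E * u r))).
    apply: eq_integral => t _.
    have mF : measurable_fun [set: R]
        (fun r => (\1_[set p : R * R | (p.1 <= p.2)%R] (t, r))%:E * u r).
      apply: emeasurable_funM => //.
      exact: (measurableT_comp mle (measurable_pair1 t)).
    rewrite ge0_integralZl//.
    - congr (_ * _).
      rewrite -[RHS](@ge0_integral_translate t _ mF); last first.
        by move=> r; rewrite mule_ge0// lee_fin.
      apply: eq_integral => s _; rewrite !indicE; congr (_%:R%:E * _).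
      by congr nat_of_bool; apply/idP/idP; rewrite !inE/= lerDl.
    - by move=> r _; rewrite mule_ge0// lee_fin.
    - by rewrite lee_fin exponential_pdf_ge0// ltW.
  rewrite (@fubini_tonelli _ _ _ _ R leb leb (fun p : R * R =>
    (exponential_pdf c p.1)%:E * ((\1_[set p : R * R | (p.1 <= p.2)%R] p)%:E * u p.2)))/=; last 2 first.
  - exact: mF2.
  - by move=> p; rewrite !mule_ge0// lee_fin// exponential_pdf_ge0// ltW.
  apply: eq_integral => r _.
  have [r0|r0] := ltP r 0%R.
    rewrite uneg// mule0 integral0_eq// => t _; by rewrite !mule0.
  rewrite -(exponential_cdf c r0) -ge0_integralZr//.
  - by apply: eq_integral => t _; rewrite muleA.
  - apply: emeasurable_funM => //.
    exact: (measurableT_comp mle (measurable_pair2 r)).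
  - by move=> t _; rewrite mule_ge0// lee_fin// exponential_pdf_ge0// ltW.
have me : measurable_fun [set: R] (fun t => (expR (- c * t))%:E).
  by apply/measurable_EFinP; apply: measurableT_comp => //; exact: measurable_funM.
have rge0 r : 0 <= (1 - expR (- c * r))%:E * u r.
  have [r0|r0] := ltP r 0%R; first by rewrite uneg// mule0.
  rewrite mule_ge0// lee_fin subr_ge0 -expR0 ler_expR.
  by rewrite mulNr oppr_le0 mulr_ge0// ltW.
have me1 : measurable_fun [set: R] (fun t => (1 - expR (- c * t))%:E).
  rewrite (_ : (fun t => _) = (fun t => 1%:E - (expR (- c * t))%:E))//.
  exact: emeasurable_funB.
rewrite E2 -ge0_integralD//.
- apply: eq_integral => r _.
  have [r0|r0] := ltP r 0%R; first by rewrite uneg// !mule0 adde0.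
  rewrite -ge0_muleDl ?lee_fin ?expR_ge0//.
    by rewrite -EFinD addrC subrK mul1e.
  rewrite subr_ge0 -expR0 ler_expR.
  by rewrite mulNr oppr_le0 mulr_ge0// ltW.
- by move=> r _; rewrite mule_ge0// lee_fin expR_ge0.
- exact: emeasurable_funM.
- exact: emeasurable_funM.
Qed.

End TimeIntegrals.

(** * Continuous paths *)

Section MeasurableLimit.
Context {d} {Om : measurableType d} {R : realType} {T : pseudoMetricType R}.

(** A limit lies in an open set U iff, for some j, the sequence is eventually
    at distance at least 1/j from the complement of U. *)
Lemma measurable_preimage_lim (E : set Om) (Z_ : nat -> Om -> T) (Z : Om -> T) :
  (forall k U, open U -> measurable (E `&` Z_ k @^-1` U)) ->
  (forall w, E w -> Z_ ^~ w @ \oo --> Z w) ->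
  forall U, open U -> measurable (E `&` Z @^-1` U).
Proof.
move=> mZ cZ U oU.
pose V j := [set y : T | ball y j.+1%:R^-1 `<=` U]^°.
have -> : E `&` Z @^-1` U =
    \bigcup_j \bigcup_N \bigcap_(k in [set k | (N <= k)%N]) (E `&` Z_ k @^-1` V j).
  apply/seteqP; split => [w [Ew UZ]|w [j _ [N _ h]]].
    have /nbhs_ballP[e /= e0 eU] : nbhs (Z w) U by exact: open_nbhs_nbhs.
    have [j je] : exists j : nat, j.+1%:R^-1 < e / 2.
      exists (Num.truncn (e / 2)^-1).
      rewrite invf_plt ?posrE ?divr_gt0//.
      by rewrite truncnS_gt.
    have : \forall y \near Z w, V j y.
      apply/nbhs_interior; apply/nbhs_ballP; exists (e / 2); first by rewrite /= divr_gt0.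
      move=> y Zy z yz; apply: eU; rewrite (splitr e).
      by apply: (ball_triangle Zy); exact: (le_ball (ltW je)).
    move=> /(cZ _ Ew)[N _ NV].
    by exists j => //; exists N => // k Nk; split => //; exact: NV.
  have [Ew _] := h N (leqnn _); split => //.
  have : \forall k \near \oo, ball (Z w) j.+1%:R^-1 (Z_ k w).
    exact: (cZ _ Ew _ (nbhsx_ballx _ _ _)).
  move=> [N' _ N'h].
  have [_ /interior_subset] := h (maxn N N') (leq_maxl _ _).
  by apply; apply: ball_sym; apply: N'h; rewrite /= leq_maxr.
apply: bigcupT_measurable => j; apply: bigcupT_measurable => N.
apply: bigcap_measurable => [|k Nk]; first by exists N => /=.
by apply: mZ; exact: open_interior.
Qed.

End MeasurableLimit.

Section Borel.
Context {R : realType} {n : nat}.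

Lemma open_measurable_rV (U : set 'rV[R]_n.+1) : open U -> measurable U.
Proof. by move=> oU; apply: sub_sigma_algebra. Qed.

Lemma closed_measurable_rV (U : set 'rV[R]_n.+1) : closed U -> measurable U.
Proof.
move=> /closed_openC cU; rewrite -[U]setCK.
by apply: measurableC; exact: open_measurable_rV.
Qed.

Lemma measurable_fun_open_rV {d} {Om : measurableType d} (E : set Om)
    (f : Om -> 'rV[R]_n.+1) :
  (forall U, open U -> measurable (E `&` f @^-1` U)) -> measurable_fun E f.
Proof.
move=> h; apply: (measurability (@open 'rV[R]_n.+1)) => //.
by move=> _ [U oU <-]; exact: h.
Qed.

Lemma measurable_fun_open_borel {d} {Om : measurableType d} {T : ptopologicalType}
    (E : set Om) (f : Om -> borel T) :
  (forall U, @open T U -> measurable (E `&` f @^-1` U)) -> measurable_fun E f.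
Proof.
move=> h; apply: (@measurability _ _ Om (borel T) E f (@open T)) => //.
by move=> _ [U oU <-]; exact: h.
Qed.

End Borel.

Section Exhaustion.
Context {R : realType} {n : nat}.
Variable D : set 'rV[R]_n.+1.
Hypothesis D_open : open D.

(** The points at distance at least 1/(k+1) from the complement of D. *)
Definition inner (k : nat) : set 'rV[R]_n.+1 :=
  ~` \bigcup_(y in ~` D) ball y k.+1%:R^-1.

Lemma closed_inner k : closed (inner k).
Proof.
apply: open_closedC; apply: bigcup_open => y _; exact: ball_open.
Qed.

Lemma inner_sub k : inner k `<=` D.
Proof.
move=> x; rewrite /inner /= => h; apply: contrapT => Dx; apply: h.
by exists x => //; exact: ballxx.
Qed.

Lemma nondecreasing_inner : {homo inner : i j / (i <= j)%N >-> i `<=` j}.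
Proof.
move=> i j ij x + [y Dy xy]; apply; exists y => //.
by apply: le_ball xy; rewrite lef_pV2 ?posrE// ler_nat.
Qed.

Lemma near_inner x : D x -> \forall y \near x & k \near \oo, inner k y.
Proof.
move=> Dx.
have /nbhs_ballP[e /= e0 eD] : nbhs x D by exact: open_nbhs_nbhs.
exists (ball x (e / 2), [set k | (Num.truncn (e / 2)^-1 <= k)%N]) => /=.
  split; first by apply: nbhsx_ballx; rewrite divr_gt0.
  by exists (Num.truncn (e / 2)^-1).
move=> [y k] /= [xy]; rewrite truncn_le_nat => ke [z Dz zy]; apply: Dz; apply: eD.
rewrite (splitr e); apply: (ball_triangle xy).
apply: ball_sym; apply: le_ball zy.
by rewrite -[leRHS]invrK lef_pV2 ?posrE ?invr_gt0 ?divr_gt0// ltW.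
Qed.

Lemma bigcup_inner : \bigcup_k inner k = D.
Proof.
apply/seteqP; split => [x [k _]|x Dx]; first exact: inner_sub.
have [[A B] /= [nA [N _ NB] AB]] := near_inner Dx.
exists N => //; apply: (AB (x, N)); split => /=.
  exact: nbhs_singleton.
by apply: NB => /=.
Qed.

Variable p : R -> 'rV[R]_n.+1.
Hypothesis p_cont : {within [set t : R | 0 <= t], continuous p}.

Lemma path_cvg (t : R) : 0 <= t ->
  p s @[s --> within [set s | 0 <= s] (nbhs t)] --> p t.
Proof.
move=> t0; rewrite nbhs_subspace_in//; exact: p_cont.
Qed.

Lemma path_cvg_seq (t : R) (t_ : nat -> R) : 0 <= t ->
  (forall k, 0 <= t_ k) -> t_ @ \oo --> t -> p (t_ k) @[k --> \oo] --> p t.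
Proof.
move=> t0 tk0 tkt U /(path_cvg t0) /tkt; rewrite /nbhs/=.
by apply: filterS => k /=; apply.
Qed.

Lemma dyadic_cvg (t : R) : 0 <= t ->
  (Num.truncn (2 ^+ k * t))%:R / 2 ^+ k @[k --> \oo] --> t.
Proof.
move=> t0.
apply: (@squeeze_cvgr _ _ _ _ (fun k : nat => t - 2^-1 ^+ k) (fun=> t)).
- apply: nearW => k; have p2 : 0 < 2 ^+ k :> R by rewrite exprn_gt0.
  have /truncn_itv/andP[h1 h2] : 0 <= 2 ^+ k * t by rewrite mulr_ge0// ltW.
  rewrite [X in _ && X]ler_pdivrMr// [t * _]mulrC h1 andbT.
  rewrite ler_pdivlMr// mulrBl exprVn mulVf ?gt_eqF//.
  by rewrite lerBlDr mulrC natr1 ltW.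
- rewrite -[X in _ --> X]subr0; apply: cvgB; first exact: cvg_cst.
  by apply: cvg_expr; rewrite ger0_norm// invf_lt1// ltr1n.
- exact: cvg_cst.
Qed.

(** Compactness of the segment and density of the dyadic grid reduce the
    uncountable condition on a continuous path to a countable one. *)
Lemma path_in_open (t : R) : 0 <= t ->
  (forall r, 0 <= r <= t -> D (p r)) <->
  exists k, forall N i, (i <= 2 ^ N)%N -> inner k (p (t * (i%:R / 2 ^+ N))).
Proof.
move=> t0; split => [h|[k h] r /andP[r0 rt]].
  have /compact_near_coveringP/(_ nat \oo
      (fun k r => 0 <= r -> inner k (p r))) : compact `[0, t].
    exact: segment_compact.
  case.
    move=> r; rewrite /= in_itv/= => /andP[r0 rt].
    have Dr : D (p r) by apply: h; rewrite r0.
    have [[A B] /= [nA nB] AB] := near_inner Dr.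
    exists ([set r' | 0 <= r' -> A (p r')], B) => /=.
      by split => //; exact: path_cvg.
    by move=> [r' k] /= [Ar' Bk] r'0; apply: (AB (p r', k)); split => //=; exact: Ar'.
  move=> k _ /(_ k (leqnn k)) hk; exists k => N i iN.
  have p2 : 0 < 2 ^+ N :> R by rewrite exprn_gt0.
  have i0 : 0 <= i%:R / 2 ^+ N :> R by rewrite divr_ge0 ?(ltW p2).
  have i1 : i%:R / 2 ^+ N <= 1 :> R.
    by rewrite ler_pdivrMr// mul1r -natrX ler_nat.
  by apply: hk => /=; rewrite ?in_itv/= mulr_ge0//= ler_piMr.
apply: (@inner_sub k).
pose th := r / t.
have th0 : 0 <= th by rewrite divr_ge0.
have th1 : th <= 1.
  rewrite /th; move: t0; rewrite le_eqVlt => /predU1P[<-|t0].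
    by rewrite invr0 mulr0.
  by rewrite ler_pdivrMr// mul1r.
have rE : r = t * th.
  move: t0; rewrite le_eqVlt => /predU1P[t0|t0].
    by apply/eqP; rewrite -t0 mul0r eq_le r0 t0 rt.
  by rewrite /th mulrC divfK// gt_eqF.
apply: (@closed_cvg _ _ \oo _
  (fun N => p (t * ((Num.truncn (2 ^+ N * th))%:R / 2 ^+ N))) (inner k)).
- exact: closed_inner.
- apply: nearW => N; apply: h.
  rewrite truncn_le_nat (@le_lt_trans _ _ (2 ^ N)%:R)// ?ltr_nat//.
  by rewrite natrX ler_piMr.
- rewrite rE; apply: path_cvg_seq; first by rewrite mulr_ge0.
    by move=> N; rewrite mulr_ge0// divr_ge0// exprn_ge0.
  by apply: cvgM; [exact: cvg_cst|exact: dyadic_cvg].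
Qed.

End Exhaustion.

Section JointMeasurability.
Context {R : realType} {n : nat} {dO : measure_display}
  {Omega : measurableType dO}.
Variable X : R -> Omega -> 'rV[R]_n.+1.
Hypothesis X_cont : forall w, {within [set t : R | 0 <= t], continuous (X ^~ w)}.

Lemma shift_path_cont (s : R) w : 0 <= s ->
  {within [set t : R | 0 <= t], continuous (fun t => X (s + t) w)}.
Proof.
move=> s0; rewrite continuous_subspace_in => t; rewrite inE /= => t0.
have h := path_cvg (@X_cont w) (addr_ge0 s0 t0).
move=> U /h /= [e /= e0 eU]; rewrite /nbhs/= -nbhs_subspace_in//=.
exists e => //= r ter r0; apply: eU => /=; last exact: addr_ge0.
by move: ter; rewrite /ball/= opprD addrACA subrr add0r.
Qed.

Lemma measurable_truncn_eq (c : R) (i : nat) :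
  measurable [set t : R | Num.truncn (c * t) = i].
Proof.
have mle j : measurable [set t : R | (Num.truncn (c * t) <= j)%N].
  rewrite (_ : [set t | _] = setT `&` (fun t => c * t) @^-1` `]-oo, j.+1%:R[); last first.
    by rewrite setTI; apply/seteqP; split => t /=; rewrite in_itv/= truncn_le_nat.
  by apply: (measurable_funM (measurable_cst c) (@measurable_id _ _ _)).
case: i => [|i].
  by rewrite (_ : [set t | _] = [set t : R | (Num.truncn (c * t) <= 0)%N])//;
     apply/seteqP; split => t /=; rewrite leqn0 => /eqP.
rewrite (_ : [set t | _] = [set t : R | (Num.truncn (c * t) <= i.+1)%N] `\`
    [set t : R | (Num.truncn (c * t) <= i)%N]).
  exact: measurableD.
apply/seteqP; split => t /=.
  by move=> ->; split => //; rewrite ltnn.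
by case=> h1 /negP; rewrite -ltnNge => h2; apply/eqP; rewrite eqn_leq h1.
Qed.

(** Continuous paths are the limits of their dyadic discretizations. *)
Lemma jointly_measurable : (forall t, 0 <= t -> measurable_fun setT (X t)) ->
  measurable_fun setT (fun p : R * Omega => X (Num.max 0 p.1) p.2).
Proof.
move=> X_meas; apply: measurable_fun_open_rV => U oU.
apply: (@measurable_preimage_lim _ (R * Omega)%type R 'rV[R]_n.+1 setT
  (fun k p => X ((Num.truncn (2 ^+ k * p.1))%:R / 2 ^+ k) p.2)
  (fun p => X (Num.max 0 p.1) p.2)) => //.
- move=> k V oV; rewrite setTI.
  rewrite (_ : _ @^-1` _ = \bigcup_i
    ([set t : R | Num.truncn (2 ^+ k * t) = i] `*` (X (i%:R / 2 ^+ k) @^-1` V))).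
    apply: bigcupT_measurable => i; apply: measurableX.
      exact: measurable_truncn_eq.
    rewrite -[X in measurable X]setTI; apply: X_meas; [|by []|exact: open_measurable_rV].
    by rewrite divr_ge0// exprn_ge0.
  apply/seteqP; split => [[t w] /= h|[t w] [i _ /= [<-]]//].
  by exists (Num.truncn (2 ^+ k * t)).
- move=> [t w] _ /=.
  have [t0|t0] := leP 0 t.
    apply: (path_cvg_seq (@X_cont w)) => //; last exact: dyadic_cvg.
  rewrite (_ : (fun k => _) = fun=> X 0 w); first exact: cvg_cst.
  apply/funext => k; rewrite (_ : Num.truncn _ = 0%N) ?mul0r//.
  apply/eqP; rewrite -leqn0 truncn_le_nat.
  by apply: (@lt_trans _ _ 0) => //; rewrite pmulr_rlt0// exprn_gt0.
Qed.

Hypothesis X_meas : forall t, 0 <= t -> measurable_fun setT (X t).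
Variable D : set 'rV[R]_n.+1.
Hypothesis D_open : open D.

Definition alive (t : R) : set Omega :=
  [set w | 0 <= t /\ forall r, 0 <= r <= t -> D (X r w)].

Lemma aliveE (t : R) w : 0 <= t ->
  alive t w <-> exists k, forall N i, (i <= 2 ^ N)%N ->
    inner D k (X (t * (i%:R / 2 ^+ N)) w).
Proof.
move=> t0; have h := path_in_open D_open (@X_cont w) t0.
by split=> [[_ /h]//|/h].
Qed.

Lemma measurable_alive2 : measurable [set p : R * Omega | alive p.1 p.2].
Proof.
rewrite (_ : [set p | _] = ([set t : R | 0 <= t] `*` setT) `&`
  \bigcup_k \bigcap_N \bigcap_(i in [set i | (i <= 2 ^ N)%N])
    (fun p : R * Omega => X (Num.max 0 (p.1 * (i%:R / 2 ^+ N))) p.2) @^-1` inner D k).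
  apply: measurableI.
    apply: measurableX => //.
    by rewrite (_ : [set t | _] = `[0, +oo[%classic)//; apply/seteqP; split => t; rewrite /= in_itv/= andbT.
  apply: bigcupT_measurable => k; apply: bigcapT_measurable => N.
  apply: bigcap_measurable => [|i iN]; first by exists 0%N.
  rewrite -[X in measurable X]setTI.
  have mf : measurable_fun setT (fun p : R * Omega => (p.1 * (i%:R / 2 ^+ N), p.2)).
    by apply: measurable_fun_pair => //; apply: measurable_funM.
  apply: (measurableT_comp (jointly_measurable X_meas) mf) => //.
  by apply: closed_measurable_rV; exact: closed_inner.
apply/seteqP; split => [[t w] /= h|[t w] /= [[t0 _] [k _ h]]].
  have t0 : 0 <= t by case: h.
  split => //; have [k hk] := (aliveE w t0).1 h.
  exists k => // N _ i /= iN; rewrite max_r//; first exact: hk.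
  by rewrite mulr_ge0// divr_ge0// exprn_ge0.
apply/(aliveE w t0); exists k => N i iN; have := h N I i iN; rewrite /= max_r//.
by rewrite mulr_ge0// divr_ge0// exprn_ge0.
Qed.

Lemma measurable_alive t : measurable (alive t).
Proof.
have := measurable_xsection t measurable_alive2; rewrite xsectionE.
exact.
Qed.

End JointMeasurability.

Section AliveAdapted.
Context {R : realType} {n : nat} {d} {Omega : measurableType d}.
Variable X : R -> Omega -> 'rV[R]_n.+1.
Variable D : set 'rV[R]_n.+1.

Lemma alive_measurable_past t : open D ->
  (forall w, {within [set t : R | 0 <= t], continuous (X ^~ w)}) ->
  (forall r, 0 <= r <= t -> measurable_fun setT (X r)) ->
  measurable (alive X D t).
Proof.
move=> D_open X_cont X_meas.
have [t0|t0] := leP 0 t; last first.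
  rewrite (_ : alive X D t = set0)// -subset0 => w [].
  by rewrite leNgt t0.
rewrite (_ : alive X D t = \bigcup_k \bigcap_N
   \bigcap_(i in [set i | (i <= 2 ^ N)%N])
    (X (t * (i%:R / 2 ^+ N)) @^-1` inner D k)).
  apply: bigcupT_measurable => k; apply: bigcapT_measurable => N.
  apply: bigcap_measurable => [|i iN]; first by exists 0%N.
  rewrite -[X in measurable X]setTI; apply: X_meas; [|by []|by apply: closed_measurable_rV; exact: closed_inner].
  have p2 : 0 < 2 ^+ N :> R by rewrite exprn_gt0.
  apply/andP; split; first by rewrite mulr_ge0// divr_ge0// ltW.
  by rewrite ler_piMr// ler_pdivrMr// mul1r -natrX ler_nat.
apply/seteqP; split => w; rewrite (aliveE X_cont D_open w t0).
  by move=> [k h]; exists k => // N _ i /= ?; exact: h.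
by move=> [k _ h]; exists k => N i iN; exact: (h N I i iN).
Qed.

End AliveAdapted.

(** * The Markov property of the process killed outside D *)

Section Mixture.
Context {d1 d2} {T1 : measurableType d1} {T2 : measurableType d2} {R : realType}.
Local Open Scope ereal_scope.
Variables (mu : {measure set T1 -> \bar R}) (D : set T1) (mD : measurable D).
Variable k : T1 -> {measure set T2 -> \bar R}.
Hypothesis mk : forall U, measurable U -> measurable_fun setT (k ^~ U).
Variable nu : {measure set T2 -> \bar R}.
Hypothesis nuE : forall U, measurable U -> nu U = \int[mu]_(x in D) k x U.

Import HBNNSimple.

Let ge0_integral_mixture_nnsfun (h : {nnsfun T2 >-> R}) :
  \int[nu]_y (h y)%:E = \int[mu]_(x in D) \int[k x]_y (h y)%:E.
Proof.
rewrite integralT_nnsfun sintegralE.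
under [RHS]eq_integral do rewrite integralT_nnsfun sintegralE.
rewrite ge0_integral_fsum//; last 2 first.
- by move=> r; apply: measurable_funeM; apply: measurable_funTS; exact: mk.
- by move=> r x _; exact: nnsfun_mulemu_ge0.
apply: eq_fsbigr => r _; rewrite nuE//.
have [r0|r0] := leP 0%R r.
  by rewrite ge0_integralZl//; apply: measurable_funTS; exact: mk.
rewrite preimage_nnfun0// integral0_eq ?mule0.
  by rewrite integral0_eq// => x _; rewrite measure0 mule0.
by move=> x _; rewrite measure0.
Qed.

Lemma ge0_integral_mixture (f : T2 -> \bar R) :
  measurable_fun setT f -> (forall y, 0 <= f y) ->
  \int[nu]_y f y = \int[mu]_(x in D) \int[k x]_y f y.
Proof.
move=> mf f0; pose f_ := nnsfun_approx measurableT mf.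
have E (ka : {measure set T2 -> \bar R}) :
    \int[ka]_y f y = limn (fun i => \int[ka]_y (f_ i y)%:E).
  rewrite -monotone_convergence//; last 3 first.
  - by move=> i; exact/measurable_EFinP.
  - by move=> i y _; rewrite lee_fin.
  - by move=> y _ a b ab; rewrite lee_fin; exact/lefP/nd_nnsfun_approx.
  by apply: eq_integral => y _; apply/esym/cvg_lim => //; exact: cvg_nnsfun_approx.
under [RHS]eq_integral do rewrite E.
rewrite E monotone_convergence//; last 3 first.
- move=> i; apply: measurable_funTS; apply: measurable_fun_integral_kernel => //.
  + by move=> y; rewrite lee_fin.
  + exact/measurable_EFinP.
- by move=> i x _; apply: integral_ge0 => y _; rewrite lee_fin.
- move=> x _ a b ab; apply: ge0_le_integral => //.
  + by move=> y _; rewrite lee_fin.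
  + exact/measurable_EFinP.
  + exact/measurable_EFinP.
  + by move=> y _; rewrite lee_fin; exact/lefP/nd_nnsfun_approx.
by congr (limn _); apply/funext => i; rewrite ge0_integral_mixture_nnsfun.
Qed.

End Mixture.

Section MixtureMeasure.
Context {d1 d2} {T1 : measurableType d1} {T2 : measurableType d2} {R : realType}.
Local Open Scope ereal_scope.
Variables (mu : {measure set T1 -> \bar R}) (D : set T1) (mD : measurable D).
Variable k : T1 -> {measure set T2 -> \bar R}.
Hypothesis mk : forall U, measurable U -> measurable_fun setT (k ^~ U).

(** The two measurability arguments make [mixture] a measure by unification. *)
Definition mixture of measurable D &
    (forall U, measurable U -> measurable_fun setT (k ^~ U)) : set T2 -> \bar R :=
  fun U => \int[mu]_(x in D) k x U.

Local Notation mix := (mixture mD mk).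

Let mixture0 : mix set0 = 0.
Proof. by apply: integral0_eq => x _; rewrite measure0. Qed.

Let mixture_ge0 U : 0 <= mix U.
Proof. by apply: integral_ge0. Qed.

Let mixture_sigma_additive : semi_sigma_additive mix.
Proof.
move=> U mU tU mUU.
have -> : mix (\bigcup_i U i) = \sum_(0 <= i <oo) mix (U i).
  rewrite /mixture -integral_nneseries//; last first.
    by move=> i; apply: measurable_funTS; exact: mk.
  by apply: eq_integral => x _; rewrite measure_semi_bigcup.
by apply: is_cvg_nneseries => i _ _.
Qed.

HB.instance Definition _ := isMeasure.Build _ _ _ mix
  mixture0 mixture_ge0 mixture_sigma_additive.

End MixtureMeasure.

Lemma measurable_indic_comp {R : realType} {d1 d2} {T1 : measurableType d1}
    {T2 : measurableType d2} (U : set T2) (f : T1 -> T2) : measurable U ->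
  measurable_fun setT f -> measurable_fun setT (fun x => \1_U (f x) : R).
Proof.
by move=> mU mf; apply: measurableT_comp mf => //; exact: measurable_indic.
Qed.

(** Both sides integrate [f] against the law of [Y] restricted to A, seen as a
    mixture of Dirac masses. *)
Lemma ge0_integral_pushforward_restr {R : realType} {d1 d2}
    {T1 : measurableType d1} {T2 : measurableType d2}
    (mu : {measure set T1 -> \bar R}) (A : set T1) (mA : measurable A)
    (Y : {mfun T1 >-> T2}) (f : T2 -> \bar R) :
  measurable_fun setT f -> (forall y, 0 <= f y)%E ->
  (\int[pushforward (mrestr mu mA) Y]_y f y = \int[mu]_(w in A) f (Y w))%E.
Proof.
move=> mf f0; rewrite (@ge0_integral_mixture _ _ T1 T2 R mu A mA
  (fun w => \d_(Y w)))//.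
- by apply: eq_integral => w _; rewrite integral_dirac// diracT mul1e.
- by move=> U mU; apply/measurable_EFinP; exact: measurable_indic_comp.
- move=> U mU; rewrite /pushforward /mrestr/=.
  transitivity (\int[mu]_(w in A) (\1_(Y @^-1` U) w)%:E)%E.
    by rewrite integral_indic// -[X in measurable X]setTI; exact: measurable_funPT.
  by apply: eq_integral => w _; rewrite indicE diracE; congr (_%:R%:E).
Qed.

Section ProbabilityKernel.
Context {d1 d2} {T1 : measurableType d1} {T2 : measurableType d2} {R : realType}.
Local Open Scope ereal_scope.
Variable P : R.-pker T1 ~> T2.

Lemma pker_le1 x A : measurable A -> P x A <= 1.
Proof. by move=> mA; rewrite -(prob_kernel (s := P) x) le_measure// inE. Qed.

Lemma pker_lty x A : measurable A -> P x A < +oo.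
Proof. by move=> mA; rewrite (le_lt_trans (pker_le1 x mA))// ltry. Qed.

Lemma pker_setC0 x A : measurable A -> P x A = 1 -> P x (~` A) = 0.
Proof.
move=> mA PA1; have PT := prob_kernel (s := P) x.
have := measureDI (P x) measurableT mA; rewrite setTD setTI.
rewrite [X in X = _]PT [X in _ + X]PA1 -[X in X = _]add0e.
by move=> /esym/(congr1 (fun z => z - 1)); rewrite !addeK.
Qed.

Definition kernel_snd {d0} {T0 : measurableType d0} (p : T0 * T1) :
  {measure set T2 -> \bar R} := P p.2.

Let measurable_kernel_snd {d0} {T0 : measurableType d0} U : measurable U ->
  measurable_fun setT (@kernel_snd d0 T0 ^~ U).
Proof.
by move=> mU; apply: (measurableT_comp (measurable_kernel P _ mU)).
Qed.

HB.instance Definition _ {d0} {T0 : measurableType d0} :=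
  isKernel.Build _ _ _ _ R (@kernel_snd d0 T0) measurable_kernel_snd.

HB.instance Definition _ {d0} {T0 : measurableType d0} :=
  Kernel_isProbability.Build _ _ _ _ R (@kernel_snd d0 T0)
    (fun p => prob_kernel (s := P) p.2).

Definition pker_prob (x : T1) : set T2 -> \bar R := P x.

HB.instance Definition _ x := Measure.on (pker_prob x).
HB.instance Definition _ x := Measure_isProbability.Build _ _ _ (pker_prob x)
  (prob_kernel (s := P) x).

End ProbabilityKernel.

Section StartingPoint.
Context {R : realType} {n : nat} {dO : measure_display}
  {Omega : measurableType dO}.
Variables (X : R -> Omega -> 'rV[R]_n.+1) (P : R.-pker 'rV[R]_n.+1 ~> Omega).
Hypothesis X_meas : forall t, 0 <= t -> measurable_fun setT (X t).
Hypothesis X_start : forall x, P x [set w | X 0 w = x] = 1%E.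

Lemma start_ae x (Q : 'rV[R]_n.+1 -> Prop) : Q x -> {ae P x, forall w, Q (X 0 w)}.
Proof.
move=> Qx; have mx : measurable [set w | X 0 w = x].
  rewrite -[X in measurable X]setTI.
  have cS : closed [set x] by exact/accessible_closed_set1/hausdorff_accessible/norm_hausdorff.
  exact: (X_meas (lexx 0) measurableT (closed_measurable_rV cS)).
exists (~` [set w | X 0 w = x]); split; first exact: measurableC.
  exact: pker_setC0.
by move=> w /= h e; apply: h; rewrite e.
Qed.

End StartingPoint.

Section Markov.
Context {R : realType} {n : nat} {dO : measure_display}
  {Omega : measurableType dO}.
Variables (X : R -> Omega -> 'rV[R]_n.+1) (P : R.-pker 'rV[R]_n.+1 ~> Omega)
  (F : R -> set (set Omega)).
Hypothesis F_filtration : is_filtration F.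
Hypothesis X_adapted : forall t (B : set 'rV[R]_n.+1),
  0 <= t -> measurable B -> F t (X t @^-1` B).
Hypothesis X_start : forall x, P x [set w | X 0 w = x] = 1%E.
Hypothesis X_cont : forall w, {within [set t : R | 0 <= t], continuous (X ^~ w)}.
Hypothesis X_markov : strong_markov X P F.

Lemma filtration_mono s t : 0 <= s <= t -> F s `<=` F t.
Proof.
move=> /andP[s0]; rewrite le_eqVlt => /predU1P[<-//|st].
by rewrite (filtration_right_continuous F_filtration s0) => A; exact.
Qed.

Lemma filtration_measurableT t A : 0 <= t -> F t A -> measurable A.
Proof. by move=> t0; exact: filtration_measurable. Qed.

Lemma process_measurable t : 0 <= t -> measurable_fun setT (X t).
Proof.
move=> t0 _ B mB; rewrite setTI; apply: (filtration_measurableT t0).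
exact: X_adapted.
Qed.

Lemma filtration_setT t : 0 <= t -> F t setT.
Proof.
move=> t0; have [h0 hC _] := filtration_sigma_algebra F_filtration t0.
by rewrite -(setD0 setT); exact: hC.
Qed.

Lemma filtration_setI t A B : 0 <= t -> F t A -> F t B -> F t (A `&` B).
Proof.
move=> t0 FA FB; have sF := filtration_sigma_algebra F_filtration t0.
have mE := measurable_g_measurableTypeE sF.
have : (F t).-sigma.-measurable (A `&` B :> set (g_sigma_algebraType (F t))).
  by apply: measurableI; rewrite mE.
by rewrite mE.
Qed.

Local Open Scope ereal_scope.

Lemma simple_markov_set x t s A B : (0 <= t)%R -> (0 <= s)%R -> F t A ->
  measurable B ->
  P x (A `&` [set w | B (X (t + s) w)]) = \int[P x]_(w in A) P (X t w) (X s @^-1` B).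
Proof.
move=> t0 s0 FA mB.
have := @X_markov (fun=> t%:E) A s B x.
rewrite /= (_ : [set w | t%:E < +oo] = setT) ?setIT; last first.
  by apply/seteqP; split => w //= _; rewrite ltry.
apply => //.
  split => // u u0; have [tu|tu] := leP t u.
    rewrite (_ : [set _ | _] = setT); first exact: filtration_setT.
    by apply/seteqP; split => w //= _; rewrite lee_fin.
  rewrite (_ : [set _ | _] = set0).
    by have [] := filtration_sigma_algebra F_filtration u0.
  by rewrite -subset0 => w /=; rewrite lee_fin leNgt tu.
split; first exact: filtration_measurableT FA.
move=> u u0; have [tu|tu] := leP t u.
  rewrite (_ : [set _ | _] = setT).
    by rewrite setIT; apply: filtration_mono FA; rewrite t0.
  by apply/seteqP; split => w //= _; rewrite lee_fin.
rewrite (_ : [set _ | _] = set0).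
  by rewrite setI0; have [] := filtration_sigma_algebra F_filtration u0.
by rewrite -subset0 => w /=; rewrite lee_fin leNgt tu.
Qed.

Lemma simple_markov x t s A (f : 'rV[R]_n.+1 -> \bar R) :
  (0 <= t)%R -> (0 <= s)%R -> F t A ->
  measurable_fun setT f -> (forall y, 0 <= f y) ->
  \int[P x]_(w in A) f (X (t + s) w) =
  \int[P x]_(w in A) \int[P (X t w)]_w' f (X s w').
Proof.
move=> t0 s0 FA mf f0.
have mA := filtration_measurableT t0 FA.
have mX := process_measurable (addr_ge0 t0 s0).
pose Ys : {mfun Omega >-> 'rV[R]_n.+1} := mfun_Sub (mem_set (process_measurable s0)).
pose Yts : {mfun Omega >-> 'rV[R]_n.+1} := mfun_Sub (mem_set mX).
have nuE U : pushforward (mrestr (P x) mA) Yts U = P x (A `&` [set w | U (X (t + s) w)]).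
  by rewrite setIC.
rewrite -(ge0_integral_pushforward_restr (P x) mA Yts mf f0).
have mk (U : set 'rV[R]_n.+1) : measurable U ->
    measurable_fun setT (fun w => pushforward (P (X t w)) Ys U).
  move=> mU.
  have mV : measurable (Ys @^-1` U) by rewrite -[X in measurable X]setTI; exact: process_measurable.
  apply: (measurableT_comp (measurable_kernel P _ mV)).
  exact: process_measurable.
rewrite (@ge0_integral_mixture _ _ Omega 'rV[R]_n.+1 R (P x) A mA
  (fun w => pushforward (P (X t w)) Ys) mk)//.
- apply: eq_integral => w _; rewrite ge0_integral_pushforward//.
- by move=> U mU; apply: (etrans (nuE U)); rewrite simple_markov_set.
Qed.

(** Finite-dimensional events: [cyl [:: (h1, B1); (h2, B2)] p] says that the
    path [p] is in B1 at time h1 and in B2 at time h1 + h2. *)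
Fixpoint cyl (l : seq (R * set 'rV[R]_n.+1)) (p : R -> 'rV[R]_n.+1) : Prop :=
  if l is (h, B) :: l' then B (p h) /\ cyl l' (fun r => p (h + r)%R) else True.

Fixpoint cyl_prob (l : seq (R * set 'rV[R]_n.+1)) (y : 'rV[R]_n.+1) : \bar R :=
  if l is (h, B) :: l' then
    \int[P y]_w ((\1_B (X h w))%:E * cyl_prob l' (X h w))
  else 1.

Fixpoint wf_cyl (l : seq (R * set 'rV[R]_n.+1)) : Prop :=
  if l is (h, B) :: l' then [/\ (0 <= h)%R, measurable B & wf_cyl l'] else True.

Lemma cyl_prob_ge0 l y : 0 <= cyl_prob l y.
Proof.
elim: l y => [|[h B] l IH] y /=; first exact: lee01.
by apply: integral_ge0 => w _; rewrite mule_ge0// lee_fin.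
Qed.

Lemma measurable_cyl_prob l : wf_cyl l -> measurable_fun setT (cyl_prob l).
Proof.
elim: l => [|[h B] l IH] /=; first by move=> _; exact: measurable_cst.
move=> [h0 mB /IH ml].
apply: (measurable_fun_integral_kernel (l := P)) => //.
- by move=> U mU; exact: measurable_kernel.
- by move=> w; rewrite mule_ge0 ?cyl_prob_ge0// lee_fin.
apply: emeasurable_funM; last exact: (measurableT_comp ml (process_measurable h0)).
apply/measurable_EFinP.
exact: measurable_indic_comp (process_measurable h0).
Qed.

Lemma measurable_cyl l t : wf_cyl l -> (0 <= t)%R ->
  measurable [set w | cyl l (fun h => X (t + h)%R w)].
Proof.
elim: l t => [|[h B] l IH] t /=; first by move=> _ _; exact: measurableT.
move=> [h0 mB wl] t0; apply: measurableI.
  rewrite -[X in measurable X]setTI; apply: (process_measurable (addr_ge0 t0 h0)) => //.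
have := IH (t + h)%R wl (addr_ge0 t0 h0).
by under eq_set do under eq_fun do rewrite -addrA.
Qed.

Lemma cyl_markov l x t A : wf_cyl l -> (0 <= t)%R -> F t A ->
  P x (A `&` [set w | cyl l (fun h => X (t + h)%R w)]) =
  \int[P x]_(w in A) cyl_prob l (X t w).
Proof.
elim: l x t A => [|[h B] l IH] x t A /=.
  move=> _ t0 FA; have mA := filtration_measurableT t0 FA.
  by rewrite integral_cst// mul1e setIT.
move=> [h0 mB wl] t0 FA; have mA := filtration_measurableT t0 FA.
have th0 := addr_ge0 t0 h0.
have FB : F (t + h)%R (A `&` X (t + h)%R @^-1` B).
  apply: filtration_setI => //; last exact: X_adapted.
  by apply: filtration_mono FA; rewrite t0 lerDl.
have := IH x (t + h)%R _ wl th0 FB.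
rewrite (_ : _ `&` _ `&` _ = A `&` [set w | B (X (t + h)%R w) /\
    cyl l (fun r => X (t + (h + r))%R w)]); last first.
  rewrite -setIA; congr (_ `&` _); apply/seteqP; split => w /= [? c]; split => //;
    move: c; congr (cyl l _); apply/funext => r; by rewrite addrA.
move=> ->; rewrite integral_mkcondr.
have mBf : measurable_fun setT (fun y => (\1_B y)%:E * cyl_prob l y).
  apply: emeasurable_funM; last exact: measurable_cyl_prob.
  exact/measurable_EFinP/measurable_indic.
rewrite -(@simple_markov x t h A (fun y => (\1_B y)%:E * cyl_prob l y))//.
  apply: eq_integral => w _; rewrite patchE indicE.
  rewrite (_ : (w \in _) = (X (t + h)%R w \in B)); last first.
    by apply/idP/idP; rewrite !inE.
  by case: ifP; rewrite ?mul1e ?mul0e.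
by move=> y; rewrite mule_ge0 ?cyl_prob_ge0// lee_fin.
Qed.

(** A set of paths whose conditional probability given the past up to time t
    is its probability for the process restarted from X_t. *)
Record markov_paths (C : set (R -> 'rV[R]_n.+1)) : Prop := {
  markov_paths_measurable : forall t, (0 <= t)%R ->
    measurable [set w | C (fun h => X (t + h)%R w)] ;
  markov_pathsE : forall x t A, (0 <= t)%R -> F t A ->
    P x (A `&` [set w | C (fun h => X (t + h)%R w)]) =
    \int[P x]_(w in A) P (X t w) [set w' | C (X ^~ w')]
}.

Lemma shift_path0 (C : set (R -> 'rV[R]_n.+1)) :
  [set w | C (fun h => X (0 + h)%R w)] = [set w | C (X ^~ w)].
Proof. by under eq_set do under eq_fun do rewrite add0r. Qed.

Lemma markov_paths_measurable0 C : markov_paths C ->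
  measurable [set w | C (X ^~ w)].
Proof.
by move=> /markov_paths_measurable/(_ 0%R (lexx _)); rewrite shift_path0.
Qed.

(** The outcome of the process restarted from X_t is compared with the
    iterated integral [cyl_prob], which [cyl_markov] finds on both sides: for the
    restarted process at time 0, where almost surely X_0 = X_t(w). *)
Lemma cyl_markov_paths l : wf_cyl l -> markov_paths (cyl l).
Proof.
move=> wl; split => [t t0|x t A t0 FA]; first exact: measurable_cyl.
rewrite cyl_markov//; apply: eq_integral => w _.
have := @cyl_markov l (X t w) 0%R setT wl (lexx _) (filtration_setT (lexx _)).
rewrite setTI; under eq_set do under eq_fun do rewrite add0r.
move=> ->; rewrite (ge0_ae_eq_integral (g := fun=> cyl_prob l (X t w)))//.
- by rewrite integral_cst// prob_kernel mule1.
- exact: (measurableT_comp (measurable_cyl_prob wl) (process_measurable _)).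
- by move=> w' _; exact: cyl_prob_ge0.
- by move=> w' _; exact: cyl_prob_ge0.
have := start_ae process_measurable X_start
  (erefl : (fun y => cyl_prob l y = cyl_prob l (X t w)) (X t w)).
by apply: filterS => w' e _.
Qed.

Lemma markov_paths_lim (C_ : nat -> set (R -> 'rV[R]_n.+1)) C :
  (forall k, markov_paths (C_ k)) ->
  (forall t, (0 <= t)%R -> measurable [set w | C (fun h => X (t + h)%R w)]) ->
  (forall x t A, (0 <= t)%R -> measurable A ->
    P x (A `&` [set w | C_ k (fun h => X (t + h)%R w)]) @[k --> \oo] -->
    P x (A `&` [set w | C (fun h => X (t + h)%R w)])) ->
  markov_paths C.
Proof.
move=> mC_ mC cC; split => // x t A t0 FA.
have mA := filtration_measurableT t0 FA.
have := cC x t A t0 mA.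
under eq_fun do rewrite (markov_pathsE (mC_ _))//.
move=> h1; apply: (cvg_unique _ h1) => //.
have cC0 y : P y [set w | C_ k (X ^~ w)] @[k --> \oo] --> P y [set w | C (X ^~ w)].
  have := cC y 0%R setT (lexx _) measurableT; rewrite setTI shift_path0.
  by under eq_fun do rewrite setTI shift_path0.
have mC0 : measurable [set w | C (X ^~ w)].
  by have := mC 0%R (lexx _); rewrite shift_path0.
have [] := @dominated_convergence _ _ _ (P x) A mA
  (fun k w => P (X t w) [set w' | C_ k (X ^~ w')])
  (fun w => P (X t w) [set w' | C (X ^~ w')]) (fun=> 1).
- move=> k; apply: measurable_funTS.
  apply: (measurableT_comp (measurable_kernel P _ _) (process_measurable _)) => //.
  exact: markov_paths_measurable0.
- apply: measurable_funTS.
  by apply: (measurableT_comp (measurable_kernel P _ _) (process_measurable _)).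
- by apply: aeW => w _; exact: cC0.
- apply/integrableP; split; first exact: measurable_cst.
  under eq_integral do rewrite abse1.
  by rewrite integral_cst// mul1e pker_lty.
- apply: aeW => w k _; rewrite gee0_abs ?measure_ge0//.
  by apply: pker_le1; exact: markov_paths_measurable0.
- by [].
Qed.

Lemma markov_paths_bigcup (C_ : nat -> set (R -> 'rV[R]_n.+1)) :
  (forall k, markov_paths (C_ k)) ->
  {homo C_ : i j / (i <= j)%N >-> i `<=` j} ->
  markov_paths (\bigcup_k C_ k).
Proof.
move=> mC_ nd.
have E t : [set w | (\bigcup_k C_ k) (fun h => X (t + h)%R w)] =
    \bigcup_k [set w | C_ k (fun h => X (t + h)%R w)] by [].
have mC t : (0 <= t)%R ->
    measurable [set w | (\bigcup_k C_ k) (fun h => X (t + h)%R w)].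
  move=> t0; rewrite E; apply: bigcupT_measurable => k.
  exact: markov_paths_measurable.
apply: (markov_paths_lim mC_ mC) => x t A t0 mA.
rewrite E setI_bigcupr.
apply: (@nondecreasing_cvg_mu _ _ _ (P x)
  (fun k => A `&` [set w | C_ k (fun h => X (t + h)%R w)])).
- by move=> k; apply: measurableI => //; exact: markov_paths_measurable.
- apply: bigcupT_measurable => k.
  by apply: measurableI => //; exact: markov_paths_measurable.
- by move=> i j ij; apply/subsetPset; apply: setIS => w; exact: nd.
Qed.

Lemma markov_paths_bigcap (C_ : nat -> set (R -> 'rV[R]_n.+1)) :
  (forall k, markov_paths (C_ k)) ->
  {homo C_ : i j / (i <= j)%N >-> j `<=` i} ->
  markov_paths (\bigcap_k C_ k).
Proof.
move=> mC_ nd.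
have E t : [set w | (\bigcap_k C_ k) (fun h => X (t + h)%R w)] =
    \bigcap_k [set w | C_ k (fun h => X (t + h)%R w)] by [].
have mC t : (0 <= t)%R ->
    measurable [set w | (\bigcap_k C_ k) (fun h => X (t + h)%R w)].
  move=> t0; rewrite E; apply: bigcapT_measurable => k.
  exact: markov_paths_measurable.
apply: (markov_paths_lim mC_ mC) => x t A t0 mA.
have mk k : measurable (A `&` [set w | C_ k (fun h => X (t + h)%R w)]).
  by apply: measurableI => //; exact: markov_paths_measurable.
rewrite E -bigcapIr; last by exists 0%N.
apply: (@nonincreasing_cvg_mu _ _ _ (P x)
  (fun k => A `&` [set w | C_ k (fun h => X (t + h)%R w)])) => //.
- exact: pker_lty.
- exact: bigcapT_measurable.
- by move=> i j ij; apply/subsetPset; apply: setIS => w; exact: nd.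
Qed.

Variable D : set 'rV[R]_n.+1.
Hypothesis D_open : open D.

Lemma cyl_nseq (c : R) (K B : set 'rV[R]_n.+1) j p :
  cyl (rcons (nseq j (c, K)) (0%R, B)) p <->
  (forall i, (0 < i <= j)%N -> K (p (i%:R * c)%R)) /\ B (p (j%:R * c)%R).
Proof.
elim: j p => [|j IH] p /=.
  by rewrite mul0r; split => [[]|[]]//; split => // -[|i].
have E i : (c + i%:R * c = i.+1%:R * c)%R by rewrite -{1}(mul1r c) -mulrDl nat1r.
rewrite IH E; split => [[Kc [Kh Bh]]|[Kh Bh]]; split => //.
- by move=> [|[|i]]// ij; [rewrite mul1r|rewrite -E; exact: Kh].
- by have := Kh 1%N isT; rewrite mul1r.
- by split => // -[|i]// ij; rewrite E; exact: Kh.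
Qed.

(** By [path_in_open] the paths that remain in D up to time s form an
    increasing union, over the compact exhaustion of D, of decreasing
    intersections, over the dyadic grids, of finite-dimensional events. *)
Lemma stays_markov_paths (s : R) B : (0 <= s)%R -> measurable B ->
  exists2 C, markov_paths C & forall t w, (0 <= t)%R ->
    C (fun h => X (t + h)%R w) <->
    (forall r, (0 <= r <= s)%R -> D (X (t + r)%R w)) /\ B (X (t + s)%R w).
Proof.
move=> s0 mB.
pose grid k N := (0%R, inner D k) ::
  rcons (nseq (2 ^ N) ((s / 2 ^+ N)%R, inner D k)) (0%R, B).
have gridP k N p : cyl (grid k N) p <->
    (forall i, (i <= 2 ^ N)%N -> inner D k (p (s * (i%:R / 2 ^+ N))%R)) /\ B (p s).
  have E i : (0 + i%:R * (s / 2 ^+ N) = s * (i%:R / 2 ^+ N))%R.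
    by rewrite add0r; ring.
  rewrite /grid [cyl _ _]/= cyl_nseq E.
  rewrite natrX divff ?expf_neq0// mulr1.
  split => [[K0 [Kh Bh]]|[Kh Bh]].
    by split => // -[|i] iN; [rewrite mul0r mulr0|rewrite -E; exact: Kh].
  split; first by have := Kh 0%N isT; rewrite mul0r mulr0.
  by split => // i /andP[_ iN]; rewrite E; exact: Kh.
have grid_markov k N : markov_paths (cyl (grid k N)).
  apply: cyl_markov_paths.
  have mK := closed_measurable_rV (@closed_inner _ _ D k).
  split => //; elim: (2 ^ N)%N => [//|j IH].
  by split => //; rewrite divr_ge0// exprn_ge0.
exists (\bigcup_k \bigcap_N (cyl (grid k N))).
  apply: markov_paths_bigcup => [k|i j ij p h N _].
    apply: markov_paths_bigcap => [N|].
      exact: grid_markov.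
    apply: (homo_leq (r := fun A B => B `<=` A)).
    - by move=> A1.
    - by move=> A1 A2 A3 h1 h2; exact: subset_trans h2 h1.
    move=> N p /gridP[Kh Bh]; apply/gridP; split => // i iN.
    have := Kh (2 * i)%N.
    rewrite expnS leq_mul2l/= => /(_ iN); congr (inner _ _ (p (_ * _)%R)).
    by rewrite natrM exprS -mulf_div divff ?mul1r// pnatr_eq0.
  have /gridP[Kh Bh] := h N I; apply/gridP; split => // i' iN.
  by apply: (nondecreasing_inner ij); exact: Kh.
move=> t w t0.
have h := path_in_open D_open (@shift_path_cont _ _ _ _ X X_cont t w t0) s0.
split => [[k _ Kh]|[Dh Bh]].
  split; last by have /gridP[] := Kh 0%N I.
  by apply/h; exists k => N i iN; have /gridP[+ _] := Kh N I; exact.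
have [k Kh] := h.1 Dh.
by exists k => // N _; apply/gridP; split => // i iN; exact: Kh.
Qed.

Lemma alive_adapted t : (0 <= t)%R -> F t (alive X D t).
Proof.
move=> t0; have mE := measurable_g_measurableTypeE (filtration_sigma_algebra F_filtration t0).
suff : (F t).-sigma.-measurable (alive X D t : set (g_sigma_algebraType (F t))).
  by rewrite mE.
apply: alive_measurable_past => // r /andP[r0 rt] _ B mB; rewrite setTI mE.
by apply: (filtration_mono (s := r)); rewrite ?r0//; exact: X_adapted.
Qed.

Lemma alive_shift s t w : (0 <= t)%R -> (0 <= s)%R ->
  alive X D (t + s) w <->
  alive X D t w /\ forall r, (0 <= r <= s)%R -> D (X (t + r)%R w).
Proof.
move=> t0 s0; split => [[_ h]|[[_ h1] h2]]; split.
- split => // r /andP[r0 rt]; apply: h; rewrite r0/= (le_trans rt)//.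
  by rewrite lerDl.
- by move=> r /andP[r0 rs]; apply: h; rewrite addr_ge0//= lerD2l.
- exact: addr_ge0.
- move=> r /andP[r0 rts]; have [rt|/ltW tr] := leP r t; first by apply: h1; rewrite r0.
  by rewrite -(subrK t r) addrC; apply: h2; rewrite subr_ge0 tr/= lerBlDl.
Qed.

(** By [stays_markov_paths], remaining in D between times t and t + s is an
    event to which the Markov property at time t applies. *)
Lemma killed_semigroup_set x t s B : (0 <= t)%R -> (0 <= s)%R -> measurable B ->
  P x (alive X D (t + s) `&` X (t + s)%R @^-1` B) =
  \int[P x]_(w in alive X D t) P (X t w) (alive X D s `&` X s @^-1` B).
Proof.
move=> t0 s0 mB.
have [C /markov_pathsE mC CE] := stays_markov_paths s0 mB.
have := mC x t _ t0 (alive_adapted t0).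
rewrite (_ : [set w' | C (X ^~ w')] = alive X D s `&` X s @^-1` B); last first.
  rewrite -shift_path0; apply/seteqP; split => w /=; rewrite (CE 0%R w (lexx _)) !add0r.
    by move=> [h Bs]; split => //; split => // r /h; rewrite add0r.
  by move=> [[_ h] Bs]; split => // r /h; rewrite add0r.
move=> <-; congr (P x _); apply/seteqP; split => w /=; rewrite (CE t w t0).
  by move=> [/(alive_shift _ t0 s0)[? ?] ?].
by move=> [? [? ?]]; split => //; apply/(alive_shift _ t0 s0).
Qed.

End Markov.

(** * The resolvent of the killed process *)

Section Resolvent.
Context {R : realType} {n : nat} {dO : measure_display}
  {Omega : measurableType dO}.
Variables (X : R -> Omega -> 'rV[R]_n.+1) (P : R.-pker 'rV[R]_n.+1 ~> Omega)
  (F : R -> set (set Omega)).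
Hypothesis F_filtration : is_filtration F.
Hypothesis X_adapted : forall t (B : set 'rV[R]_n.+1),
  0 <= t -> measurable B -> F t (X t @^-1` B).
Hypothesis X_start : forall x, P x [set w | X 0 w = x] = 1%E.
Hypothesis X_cont : forall w, {within [set t : R | 0 <= t], continuous (X ^~ w)}.
Hypothesis X_markov : strong_markov X P F.
Variable D : set 'rV[R]_n.+1.
Hypothesis D_open : open D.

Local Open Scope ereal_scope.
Notation leb := (@lebesgue_measure R).
Implicit Types (f h : 'rV[R]_n.+1 -> \bar R) (x : 'rV[R]_n.+1).

Let X_meas := process_measurable F_filtration X_adapted.
Let m_alive t : measurable (alive X D t) := measurable_alive X_cont X_meas D_open t.

(** [E_x[f(X_t); t < tau_D]], zero for negative t. *)
Definition killed f t x : \bar R := \int[P x]_(w in alive X D t) f (X t w).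

Lemma alive_neg t : (t < 0)%R -> alive X D t = set0.
Proof. by move=> t0; rewrite -subset0 => w []; rewrite leNgt t0. Qed.

Lemma killed_neg f t x : (t < 0)%R -> killed f t x = 0.
Proof. by move=> t0; rewrite /killed alive_neg// integral_set0. Qed.

Lemma killed_ge0 f t x : (forall y, 0 <= f y) -> 0 <= killed f t x.
Proof. by move=> f0; apply: integral_ge0. Qed.

Lemma killedE f t x : killed f t x =
  \int[P x]_w ((\1_[set p : R * Omega | alive X D p.1 p.2] (t, w))%:E *
               f (X (Num.max 0%R t) w)).
Proof.
have [t0|t0] := leP 0%R t; last first.
  rewrite killed_neg// integral0_eq// => w _.
  by rewrite indicE memNset ?mul0e//= alive_neg.
rewrite /killed integral_mkcond; apply: eq_integral => w _.
rewrite patchE indicE.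
rewrite (_ : (_ \in [set p | _]) = (w \in alive X D t)); last first.
  by apply/idP/idP; rewrite !inE.
by case: ifP; rewrite ?mul1e ?mul0e.
Qed.

Lemma measurable_killed_integrand f : measurable_fun setT f ->
  measurable_fun setT (fun p : R * Omega =>
    (\1_[set p : R * Omega | alive X D p.1 p.2] p)%:E * f (X (Num.max 0%R p.1) p.2)).
Proof.
move=> mf; apply: emeasurable_funM.
  apply/measurable_EFinP; apply: measurable_indic.
  exact: measurable_alive2.
exact: (measurableT_comp mf (jointly_measurable X_cont X_meas)).
Qed.

Lemma measurable_killed2 f : measurable_fun setT f -> (forall y, 0 <= f y) ->
  measurable_fun setT (fun p : R * 'rV[R]_n.+1 => killed f p.1 p.2).
Proof.
move=> mf f0; under eq_fun do rewrite killedE.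
apply: (measurable_fun_integral_finite_kernel
  (fun q : (R * 'rV[R]_n.+1) * Omega =>
    (\1_[set p : R * Omega | alive X D p.1 p.2] (q.1.1, q.2))%:E *
       f (X (Num.max 0%R q.1.1) q.2)) (kernel_snd P)).
  by move=> q; rewrite mule_ge0// lee_fin.
apply: (measurableT_comp (measurable_killed_integrand mf)) => //.
apply: measurable_fun_pair => //.
by apply: measurableT_comp => //.
Qed.

Lemma measurable_killed f t : measurable_fun setT f -> (forall y, 0 <= f y) ->
  measurable_fun setT (killed f t).
Proof.
by move=> mf f0; apply: (measurableT_comp (measurable_killed2 mf f0) (measurable_pair1 t)).
Qed.

Lemma measurable_killed_time f x : measurable_fun setT f -> (forall y, 0 <= f y) ->
  measurable_fun setT (fun t => killed f t x).
Proof.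
by move=> mf f0; apply: (measurableT_comp (measurable_killed2 mf f0) (measurable_pair2 x)).
Qed.

Lemma measurable_process_comp f t : (0 <= t)%R -> measurable_fun setT f ->
  measurable_fun (alive X D t) (fun w => f (X t w)).
Proof.
by move=> t0 mf; apply: measurable_funTS; apply: (measurableT_comp mf); exact: X_meas.
Qed.

Lemma le_killed f h t x : measurable_fun setT f -> measurable_fun setT h ->
  (forall y, 0 <= f y) -> (forall y, f y <= h y) -> killed f t x <= killed h t x.
Proof.
move=> mf mh f0 fh; have [t0|t0] := ltP t 0%R; first by rewrite !killed_neg.
apply: ge0_le_integral => //.
- exact: measurable_process_comp.
- exact: measurable_process_comp.
Qed.

Lemma killedD f h t x : measurable_fun setT f -> measurable_fun setT h ->
  (forall y, 0 <= f y) -> (forall y, 0 <= h y) ->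
  killed (fun y => f y + h y) t x = killed f t x + killed h t x.
Proof.
move=> mf mh f0 h0; have [t0|t0] := ltP t 0%R; first by rewrite !killed_neg// adde0.
rewrite /killed ge0_integralD//.
- exact: measurable_process_comp.
- exact: measurable_process_comp.
Qed.

Lemma killedZ f (k : R) t x : measurable_fun setT f ->
  (forall y, 0 <= f y) -> (0 <= k)%R ->
  killed (fun y => k%:E * f y) t x = k%:E * killed f t x.
Proof.
move=> mf f0 k0; have [t0|t0] := ltP t 0%R; first by rewrite !killed_neg// mule0.
by rewrite /killed ge0_integralZl//; exact: measurable_process_comp.
Qed.

Lemma killed_cst1_le1 t x : killed (fun=> 1) t x <= 1.
Proof. by rewrite /killed integral_cst// mul1e pker_le1. Qed.

Lemma killed_semigroup f t s x : (0 <= t)%R -> (0 <= s)%R ->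
  measurable_fun setT f -> (forall y, 0 <= f y) ->
  killed f (t + s) x = killed (killed f s) t x.
Proof.
move=> t0 s0 mf f0.
pose Ys : {mfun Omega >-> 'rV[R]_n.+1} := mfun_Sub (mem_set (X_meas s0)).
pose Yts : {mfun Omega >-> 'rV[R]_n.+1} := mfun_Sub (mem_set (X_meas (addr_ge0 t0 s0))).
rewrite /killed -(ge0_integral_pushforward_restr (P x) (m_alive (t + s)) Yts mf f0).
rewrite (@ge0_integral_mixture _ _ Omega 'rV[R]_n.+1 R (P x) _ (m_alive t)
  (fun w => pushforward (mrestr (P (X t w)) (m_alive s)) Ys) _)//.
- apply: eq_integral => w _.
  by rewrite (ge0_integral_pushforward_restr (P (X t w)) (m_alive s) Ys mf f0).
- move=> U mU; have mV : measurable (Ys @^-1` U `&` alive X D s).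
    by apply: measurableI => //; rewrite -[X in measurable X]setTI; exact: (X_meas s0).
  by apply: (measurableT_comp (measurable_kernel P _ mV)); exact: X_meas.
- move=> U mU.
  transitivity (P x (alive X D (t + s) `&` X (t + s)%R @^-1` U)).
    by rewrite setIC.
  rewrite (killed_semigroup_set F_filtration)//.
  by apply: eq_integral => w _; rewrite setIC.
Qed.

Definition resolvent (b : R) f x : \bar R :=
  \int[leb]_t ((expR (- (b * t)))%:E * killed f t x).

Lemma resolvent_ge0 b f x : (forall y, 0 <= f y) -> 0 <= resolvent b f x.
Proof.
move=> f0; apply: integral_ge0 => t _.
by rewrite mule_ge0 ?killed_ge0// lee_fin expR_ge0.
Qed.

Lemma measurable_expR_rate (b : R) :
  measurable_fun setT (fun t : R => (expR (- (b * t)))%:E).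
Proof.
apply/measurable_EFinP; apply: measurableT_comp => //.
by apply: measurableT_comp => //; exact: measurable_funM.
Qed.

Lemma measurable_resolvent_integrand b f : measurable_fun setT f ->
  (forall y, 0 <= f y) -> measurable_fun setT
    (fun p : R * 'rV[R]_n.+1 => (expR (- (b * p.1)))%:E * killed f p.1 p.2).
Proof.
move=> mf f0; apply: emeasurable_funM; last exact: measurable_killed2.
exact: (measurableT_comp (measurable_expR_rate b) measurable_fst).
Qed.

Lemma measurable_resolvent b f : measurable_fun setT f ->
  (forall y, 0 <= f y) -> measurable_fun setT (resolvent b f).
Proof.
move=> mf f0.
have h : measurable_fun setT (fun p : 'rV[R]_n.+1 * R => (expR (- (b * p.2)))%:E * killed f p.2 p.1).
  have ms : measurable_fun setT (fun p : 'rV[R]_n.+1 * R => (p.2, p.1)).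
    exact: measurable_fun_pair.
  exact: (measurableT_comp (measurable_resolvent_integrand b mf f0) ms).
apply: (measurable_fun_fubini_tonelli_F (m2 := leb)
  (fun p : 'rV[R]_n.+1 * R => (expR (- (b * p.2)))%:E * killed f p.2 p.1)) => //.
by move=> p; rewrite mule_ge0 ?killed_ge0// lee_fin expR_ge0.
Qed.

Lemma measurable_resolvent_time b f x : measurable_fun setT f ->
  (forall y, 0 <= f y) ->
  measurable_fun setT (fun t : R => (expR (- (b * t)))%:E * killed f t x).
Proof.
move=> mf f0; apply: emeasurable_funM; last exact: measurable_killed_time.
exact: measurable_expR_rate.
Qed.

(** The time integral is split at an independent exponential time of rate b - a;
    by the semigroup property, what comes after that time is the resolvent of
    rate a started afresh. *)
Lemma resolvent_eq (a b : R) f x : (a < b)%R ->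
  measurable_fun setT f -> (forall y, 0 <= f y) ->
  resolvent a f x =
  resolvent b f x + (b - a)%:E * resolvent b (resolvent a f) x.
Proof.
move=> ab mf f0.
have c0 : (0 < b - a)%R by rewrite subr_gt0.
have e0 t : 0 <= (expR (- (a * t)))%:E * killed f t x.
  by rewrite mule_ge0 ?killed_ge0// lee_fin expR_ge0.
have mU := measurable_resolvent a mf f0.
have U0 y : 0 <= resolvent a f y by exact: resolvent_ge0.
rewrite {1}/resolvent (exponential_split c0)//; last 2 first.
- exact: measurable_resolvent_time.
- by move=> t t0; rewrite killed_neg// mule0.
congr (_ + _).
  apply: eq_integral => t _; rewrite muleA -EFinM -expRD; congr ((expR _)%:E * _).
  by ring.
rewrite {1}/resolvent -ge0_integralZl//; last 3 first.
- exact: measurable_resolvent_time.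
- by move=> t _; rewrite mule_ge0 ?killed_ge0// lee_fin expR_ge0.
- by rewrite lee_fin ltW.
apply: eq_integral => t _.
have [t0|t0] := ltP t 0%R.
  by rewrite lt0_exponential_pdf// mul0e killed_neg// !mule0.
rewrite exponential_pdfE// EFinM -muleA; congr (_ * _).
have -> : (expR (- (b * t)))%:E =
    (expR (- (b - a) * t))%:E * (expR (- (a * t)))%:E :> \bar R.
  by rewrite -EFinM -expRD; congr ((expR _)%:E); ring.
rewrite -muleA; congr (_ * _).
have mks : measurable_fun setT (fun p : R * Omega =>
    (expR (- (a * p.1)))%:E * killed f p.1 (X t p.2)).
  have mtx : measurable_fun setT (fun p : R * Omega => (p.1, X t p.2)).
    by apply: measurable_fun_pair => //; apply: (measurableT_comp (X_meas t0)).
  exact: (measurableT_comp (measurable_resolvent_integrand a mf f0) mtx).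
have ks0 s w : 0 <= (expR (- (a * s)))%:E * killed f s (X t w).
  by rewrite mule_ge0 ?killed_ge0// lee_fin expR_ge0.
have mF : measurable_fun setT (fun p : R * Omega =>
    (\1_(alive X D t) p.2)%:E *
    ((expR (- (a * p.1)))%:E * killed f p.1 (X t p.2))).
  apply: emeasurable_funM => //; apply/measurable_EFinP.
  exact: measurable_indic_comp.
have F0 (p : R * Omega) : 0 <= (\1_(alive X D t) p.2)%:E *
    ((expR (- (a * p.1)))%:E * killed f p.1 (X t p.2)).
  by rewrite mule_ge0// lee_fin.
have restrE (g : Omega -> \bar R) : \int[P x]_(w in alive X D t) g w =
    \int[P x]_w ((\1_(alive X D t) w)%:E * g w).
  rewrite integral_mkcond; apply: eq_integral => w _; rewrite patchE indicE.
  by case: ifP; rewrite ?mul1e ?mul0e.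
transitivity (\int[leb]_s ((expR (- (a * t)))%:E *
    \int[P x]_w ((\1_(alive X D t) w)%:E *
      ((expR (- (a * s)))%:E * killed f s (X t w))))).
  apply: eq_integral => s _; rewrite indicE.
  have [s0|s0] := leP 0%R s; last first.
    rewrite memNset/=; last by apply/negP; rewrite -ltNge.
    by rewrite mul0e integral0_eq ?mule0// => w _; rewrite killed_neg// !mule0.
  rewrite mem_set//= mul1e killed_semigroup//.
  rewrite -restrE ge0_integralZl//; last 2 first.
  - by apply: measurable_process_comp => //; exact: measurable_killed.
  - by move=> w _; exact: killed_ge0.
  by rewrite muleA -EFinM -expRD; congr ((expR _)%:E * _); ring.
rewrite ge0_integralZl//; last 2 first.
- apply: (measurable_fun_fubini_tonelli_F (m2 := pker_prob P x)
    (fun p : R * Omega => (\1_(alive X D t) p.2)%:E *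
    ((expR (- (a * p.1)))%:E * killed f p.1 (X t p.2)))) => //.
- by move=> s _; apply: integral_ge0 => w _; rewrite mule_ge0// lee_fin.
congr (_ * _).
transitivity (\int[P x]_w \int[leb]_s ((\1_(alive X D t) w)%:E *
    ((expR (- (a * s)))%:E * killed f s (X t w)))).
  exact: (fubini_tonelli (m1 := leb) (m2 := pker_prob P x) (fun p : R * Omega =>
    (\1_(alive X D t) p.2)%:E *
    ((expR (- (a * p.1)))%:E * killed f p.1 (X t p.2)))).
rewrite /killed restrE; apply: eq_integral => w _.
rewrite ge0_integralZl//; first exact: measurable_resolvent_time.
by move=> s _; exact: ks0.
Qed.

Lemma le_resolvent b f h x : measurable_fun setT f -> measurable_fun setT h ->
  (forall y, 0 <= f y) -> (forall y, f y <= h y) ->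
  resolvent b f x <= resolvent b h x.
Proof.
move=> mf mh f0 fh; have h0 y : 0 <= h y by exact: le_trans (fh y).
apply: ge0_le_integral => //.
- by move=> t _; rewrite mule_ge0 ?killed_ge0// lee_fin expR_ge0.
- exact: measurable_resolvent_time.
- exact: measurable_resolvent_time.
- by move=> t _; rewrite lee_wpmul2l ?lee_fin ?expR_ge0// le_killed.
Qed.

Lemma le_resolvent_rate a b f x : (a <= b)%R -> measurable_fun setT f ->
  (forall y, 0 <= f y) -> resolvent b f x <= resolvent a f x.
Proof.
move=> ab mf f0; apply: ge0_le_integral => //.
- by move=> t _; rewrite mule_ge0 ?killed_ge0// lee_fin expR_ge0.
- exact: measurable_resolvent_time.
- exact: measurable_resolvent_time.
- move=> t _; have [t0|t0] := ltP t 0%R; first by rewrite !killed_neg// !mule0.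
  rewrite lee_wpmul2r ?killed_ge0// lee_fin ler_expR lerN2.
  by rewrite ler_wpM2r.
Qed.

Lemma resolventD b f h x : measurable_fun setT f -> measurable_fun setT h ->
  (forall y, 0 <= f y) -> (forall y, 0 <= h y) ->
  resolvent b (fun y => f y + h y) x = resolvent b f x + resolvent b h x.
Proof.
move=> mf mh f0 h0; rewrite /resolvent -ge0_integralD//.
- apply: eq_integral => t _; rewrite killedD// ge0_muleDr//; exact: killed_ge0.
- by move=> t _; rewrite mule_ge0 ?killed_ge0// lee_fin expR_ge0.
- exact: measurable_resolvent_time.
- by move=> t _; rewrite mule_ge0 ?killed_ge0// lee_fin expR_ge0.
- exact: measurable_resolvent_time.
Qed.

Lemma resolventZ b f (k : R) x : measurable_fun setT f ->
  (forall y, 0 <= f y) -> (0 <= k)%R ->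
  resolvent b (fun y => k%:E * f y) x = k%:E * resolvent b f x.
Proof.
move=> mf f0 k0; rewrite /resolvent -ge0_integralZl//.
- by apply: eq_integral => t _; rewrite killedZ// muleCA.
- exact: measurable_resolvent_time.
- by move=> t _; rewrite mule_ge0 ?killed_ge0// lee_fin expR_ge0.
Qed.

Lemma resolvent_cst_le b (k : R) x : (0 < b)%R -> (0 <= k)%R ->
  b%:E * resolvent b (fun=> k%:E) x <= k%:E.
Proof.
move=> b0 k0.
have -> : resolvent b (fun=> k%:E) x = k%:E * resolvent b (fun=> 1) x.
  by rewrite -{1}[k%:E]mule1 (@resolventZ b (fun=> 1)).
rewrite muleCA -[leRHS]mule1 lee_wpmul2l ?lee_fin//.
rewrite -[leRHS](integral_exponential_pdf b0) /resolvent.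
have mr : measurable_fun setT (fun t : R => (expR (- (b * t)))%:E * killed (fun=> 1) t x).
  by apply: measurable_resolvent_time.
rewrite -ge0_integralZl//; last 2 first.
- by move=> t _; rewrite mule_ge0 ?killed_ge0// lee_fin expR_ge0.
- by rewrite lee_fin ltW.
apply: ge0_le_integral => //.
- by move=> t _; rewrite !mule_ge0 ?killed_ge0// lee_fin ?expR_ge0// ltW.
- exact: emeasurable_funM.
- by apply/measurable_EFinP; exact: measurable_exponential_pdf.
move=> t _; have [t0|t0] := ltP t 0%R.
  by rewrite killed_neg// !mule0 lee_fin exponential_pdf_ge0// ltW.
rewrite exponential_pdfE// EFinM mulNr lee_wpmul2l ?lee_fin ?(ltW b0)//.
by rewrite -[leRHS]mule1 lee_wpmul2l ?lee_fin ?expR_ge0// killed_cst1_le1.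
Qed.

End Resolvent.

(** * The domination principle *)

Section Domination.
Context {R : realType} {d} {T : measurableType d}.
Local Open Scope ereal_scope.
Implicit Types (f h : T -> \bar R) (x : T).

(** A sub-Markovian resolvent, on nonnegative measurable functions; at [b = 0]
    it may take infinite values. *)
Record submarkov_resolvent (U : R -> (T -> \bar R) -> T -> \bar R) : Prop := {
  U_ge0 : forall b f x, (forall y, 0 <= f y) -> 0 <= U b f x ;
  measurable_U : forall b f, measurable_fun setT f -> (forall y, 0 <= f y) ->
    measurable_fun setT (U b f) ;
  le_U : forall b f h x, measurable_fun setT f -> measurable_fun setT h ->
    (forall y, 0 <= f y) -> (forall y, f y <= h y) -> U b f x <= U b h x ;
  le_U_rate : forall a b f x, (a <= b)%R -> measurable_fun setT f ->
    (forall y, 0 <= f y) -> U b f x <= U a f x ;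
  U_D : forall b f h x, measurable_fun setT f -> measurable_fun setT h ->
    (forall y, 0 <= f y) -> (forall y, 0 <= h y) ->
    U b (fun y => f y + h y) x = U b f x + U b h x ;
  U_Z : forall b f (k : R) x, measurable_fun setT f ->
    (forall y, 0 <= f y) -> (0 <= k)%R ->
    U b (fun y => k%:E * f y) x = k%:E * U b f x ;
  U_cst_le : forall b (k : R) x, (0 < b)%R -> (0 <= k)%R ->
    b%:E * U b (fun=> k%:E) x <= k%:E ;
  U_eq : forall (a b : R) f x, (a < b)%R ->
    measurable_fun setT f -> (forall y, 0 <= f y) ->
    U a f x = U b f x + (b - a)%:E * U b (U a f) x ;
  U_lim : forall f x, measurable_fun setT f -> (forall y, 0 <= f y) ->
    (fun i : nat => U (i.+1%:R^-1)%R (fun y => Order.min (f y) (i%:R)%:E) x) @ \oo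
      --> U 0%R f x
}.

Variable U : R -> (T -> \bar R) -> T -> \bar R.
Hypothesis HU : submarkov_resolvent U.

(** The bounded case of the domination principle, before the limit in the
    parameters. With [Q = l U_(l + mu)], the bounded function
    [u = f + l U_mu f] satisfies [u = f + Q u], while
    [s = k + l U_0 h] satisfies [Q s <= s]. An excess of [u] over [s] can only
    occur where [f] vanishes, so it is at most [Q] of itself, and [Q] shrinks
    constants by the factor [l / (l + mu)]. *)
Lemma domination_bounded f h (k mu l : R) : (0 < mu)%R -> (0 < l)%R ->
  measurable_fun setT f -> measurable_fun setT h ->
  (forall y, 0 <= f y) -> (forall y, 0 <= h y) -> (forall y, f y <= k%:E) ->
  (forall y, 0 < f y -> U 0 f y <= U 0 h y) ->
  forall x, f x + l%:E * U mu f x <= k%:E + l%:E * U 0 h x.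
Proof.
move=> mu0 l0 mf mh f0 h0 fk fh.
have k0 : (0 <= k)%R by rewrite -lee_fin (le_trans (f0 point)).
have lmu0 : (0 < l + mu)%R by exact: addr_gt0.
have mUf := measurable_U HU mu mf f0.
have mUh := measurable_U HU 0 mh h0.
have Uf0 y : 0 <= U mu f y by exact: (U_ge0 HU).
have Uh0 y : 0 <= U 0 h y by exact: (U_ge0 HU).
pose u y := f y + l%:E * U mu f y.
pose s y := k%:E + l%:E * U 0 h y.
have lE0 : 0 <= l%:E by rewrite lee_fin ltW.
have mlUf : measurable_fun setT (fun y => l%:E * U mu f y).
  exact: measurable_funeM.
have mlUh : measurable_fun setT (fun y => l%:E * U 0 h y).
  exact: measurable_funeM.
have mu_ : measurable_fun setT u by exact: emeasurable_funD.
have ms_ : measurable_fun setT s by exact: emeasurable_funD.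
have u0 y : 0 <= u y by rewrite adde_ge0// mule_ge0.
have s0 y : 0 <= s y by rewrite adde_ge0 ?lee_fin// mule_ge0.
pose Q g y := l%:E * U (l + mu) g y.
have uE y : u y = f y + Q u y.
  rewrite /u /Q; congr (_ + _ * _).
  rewrite (@U_eq U HU mu (l + mu)%R)//; last by rewrite ltrDr.
  rewrite -(U_Z HU)//; last by rewrite addrK ltW.
  rewrite addrK -(U_D HU)// => y'; by rewrite mule_ge0.
have Qcst (c : R) y : (0 <= c)%R -> Q (fun=> c%:E) y <= (l / (l + mu) * c)%:E.
  move=> c0; have := @U_cst_le U HU (l + mu)%R c y lmu0 c0.
  rewrite -(@lee_pmul2l _ (l / (l + mu))%:E)//; last by rewrite lte_fin divr_gt0.
  by rewrite muleA -EFinM divfK// gt_eqF.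
have Qs y : Q s y <= s y.
  rewrite /Q /s (U_D HU)//; last by move=> y'; rewrite mule_ge0.
  rewrite ge0_muleDr ?(U_ge0 HU)//; last by move=> y'; rewrite mule_ge0.
  apply: leeD.
    apply: le_trans (Qcst k y k0) _; rewrite lee_fin ler_piMl//.
    by rewrite ler_pdivrMr// mul1r lerDl ltW.
  rewrite lee_wpmul2l// (@U_eq U HU 0%R (l + mu)%R h y)// subr0 (U_Z HU) ?(ltW l0)//.
  rewrite -[leLHS]add0e leeD ?(U_ge0 HU)// lee_wpmul2r ?(U_ge0 HU)// lee_fin.
  by rewrite lerDl ltW.
have step (c : R) : (0 <= c)%R -> (forall y, u y <= s y + c%:E) ->
    forall y, u y <= s y + (l / (l + mu) * c)%:E.
  move=> c0 uc y; have c0' : 0 <= (l / (l + mu) * c)%:E.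
    by rewrite lee_fin mulr_ge0// divr_ge0 ?ltW.
  have [fy|fy] := ltP 0 (f y).
    rewrite -[leLHS]adde0 leeD// /u /s leeD// lee_wpmul2l//.
    by rewrite (le_trans _ (fh y fy))// (le_U_rate HU)// ltW.
  have fy0 : f y = 0 by apply/eqP; rewrite eq_le fy f0.
  rewrite uE fy0 add0e.
  apply: (@le_trans _ _ (Q (fun y => s y + c%:E) y)).
    rewrite /Q lee_wpmul2l// (le_U HU)//.
    exact: emeasurable_funD.
  rewrite /Q (U_D HU)// ge0_muleDr ?(U_ge0 HU)//.
  by rewrite leeD// ?Qs// Qcst.
pose C := (k + l * (k / mu))%R.
have C0 : (0 <= C)%R by rewrite addr_ge0// mulr_ge0 ?divr_ge0// ltW.
have base y : u y <= s y + C%:E.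
  rewrite -[leLHS]add0e leeD// EFinD leeD// EFinM lee_wpmul2l//.
  have := @U_cst_le U HU mu k y mu0 k0.
  rewrite -(@lee_pdivlMl _ mu)// mulrC => h1.
  by apply: le_trans h1; exact: (le_U HU).
have iter_bound i y : u y <= s y + ((l / (l + mu)) ^+ i * C)%:E.
  elim: i y => [|i IH] y; first by rewrite expr0 mul1r.
  rewrite exprS -mulrA; apply: step => //.
  by rewrite mulr_ge0// exprn_ge0// divr_ge0 ?ltW.
move=> x; apply/lee_addgt0Pr => e e0.
have : ((l / (l + mu)) ^+ i * C)%R @[i --> \oo] --> 0%R.
  rewrite -[X in _ --> X](mul0r C); apply: cvgM; last exact: cvg_cst.
  apply: cvg_expr; rewrite ger0_norm ?divr_ge0 ?ltW//.
  by rewrite ltr_pdivrMr// mul1r ltrDl.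
move=> /cvgrPdist_le /(_ e e0)[N _ /(_ N (leqnn N))/=].
rewrite sub0r normrN => hN.
apply: le_trans (iter_bound N x) _; rewrite leeD// lee_fin.
exact: le_trans (ler_norm _) hN.
Qed.

(** In [domination_bounded], dividing by l and letting l tend to infinity removes
    f and the bound k; then mu decreases to 0 while f is approximated by its
    truncations. *)
Lemma domination f h : measurable_fun setT f -> measurable_fun setT h ->
  (forall y, 0 <= f y) -> (forall y, 0 <= h y) ->
  (forall y, 0 < f y -> U 0 f y <= U 0 h y) ->
  forall x, U 0 f x <= U 0 h x.
Proof.
move=> mf mh f0 h0 fh x.
have cU := @U_lim U HU f x mf f0; rewrite -(cvg_lim _ cU)//.
apply: lime_le; first by apply/cvg_ex; eexists; exact: cU.
apply: nearW => i.
pose fi y := Order.min (f y) (i%:R)%R%:E.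
have fi0 y : 0 <= fi y by rewrite le_min f0 lee_fin ler0n.
have fif y : fi y <= f y by rewrite ge_min lexx.
have fik y : fi y <= (i%:R)%R%:E by rewrite ge_min lexx orbT.
have mfi : measurable_fun setT fi by exact: measurable_mine.
apply/lee_addgt0Pr => e e0.
pose l : R := (i.+1%:R / e)%R.
have l0 : (0 < l)%R by rewrite divr_gt0.
have : fi x + l%:E * U (i.+1%:R^-1)%R fi x <= (i%:R)%R%:E + l%:E * U 0 h x.
  have i0 : (0 < i.+1%:R^-1 :> R)%R by rewrite invr_gt0.
  apply: (domination_bounded i0 l0 mfi mh fi0 h0 fik).
  move=> y fiy; have fy : 0 < f y by exact: lt_le_trans (fif y).
  by apply: le_trans (fh y fy); exact: (le_U HU).
move=> H; rewrite -(@lee_pmul2l _ l%:E)// ?lte_fin//.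
apply: (@le_trans _ _ ((i%:R)%R%:E + l%:E * U 0 h x)).
  by apply: le_trans H; rewrite leeDr.
rewrite addeC ge0_muleDr ?(U_ge0 HU)//; last by rewrite lee_fin ltW.
rewrite leeD2l// -EFinM lee_fin /l divfK ?gt_eqF//.
by rewrite ler_nat.
Qed.

End Domination.

Section KilledResolvent.
Context {R : realType} {n : nat} {dO : measure_display}
  {Omega : measurableType dO}.
Variables (X : R -> Omega -> 'rV[R]_n.+1) (P : R.-pker 'rV[R]_n.+1 ~> Omega)
  (F : R -> set (set Omega)).
Hypothesis F_filtration : is_filtration F.
Hypothesis X_adapted : forall t (B : set 'rV[R]_n.+1),
  0 <= t -> measurable B -> F t (X t @^-1` B).
Hypothesis X_start : forall x, P x [set w | X 0 w = x] = 1%E.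
Hypothesis X_cont : forall w, {within [set t : R | 0 <= t], continuous (X ^~ w)}.
Hypothesis X_markov : strong_markov X P F.
Variable D : set 'rV[R]_n.+1.
Hypothesis D_open : open D.

Local Open Scope ereal_scope.
Notation leb := (@lebesgue_measure R).
Let X_meas := process_measurable F_filtration X_adapted.

Lemma cvg_min_natr (y : \bar R) : 0 <= y ->
  Order.min y (i%:R)%:E @[i --> \oo] --> y.
Proof.
case: y => [r| |] // r0; last first.
  rewrite (_ : (fun i : nat => _) = (fun i : nat => (i%:R)%:E)).
    exact/cvgeryP/cvgr_idn.
  by apply/funext => i; rewrite min_r// leey.
apply: cvg_near_cst; exists (Num.truncn r).+1 => // i /= ri.
apply/eqP; rewrite eq_minl lee_fin ltW//.
by rewrite (lt_le_trans (truncnS_gt r))// ler_nat.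
Qed.

Lemma nondecreasing_min_natr (y : \bar R) :
  {homo (fun i : nat => Order.min y (i%:R)%:E) : i j / (i <= j)%N >-> i <= j}.
Proof. by move=> i j ij; rewrite le_min !ge_min lexx/= lee_fin ler_nat ij orbT. Qed.

Lemma min_natr_ge0 (y : \bar R) (i : nat) : 0 <= y -> 0 <= Order.min y (i%:R)%:E.
Proof. by move=> y0; rewrite le_min y0 lee_fin/=. Qed.

Lemma cvg_killed_min (f : 'rV[R]_n.+1 -> \bar R) t x : measurable_fun setT f ->
  (forall y, 0 <= f y) ->
  killed X P D (fun y => Order.min (f y) (i%:R)%:E) t x @[i --> \oo] -->
  killed X P D f t x.
Proof.
move=> mf f0; have [t0|t0] := ltP t 0%R.
  by rewrite killed_neg//; under eq_fun do rewrite killed_neg//; exact: cvg_cst.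
have m_alive := measurable_alive X_cont X_meas D_open t.
have mfi i : measurable_fun setT (fun y => Order.min (f y) (i%:R)%:E).
  exact: measurable_mine.
have := @cvg_monotone_convergence _ _ _ (P x) _ m_alive
  (fun i w => Order.min (f (X t w)) (i%:R)%:E).
rewrite (_ : \int[P x]_(w in _) limn _ = killed X P D f t x); last first.
  apply: eq_integral => w _; apply/cvg_lim => //; exact: cvg_min_natr.
apply.
- move=> i; apply: measurable_funTS; apply: (measurableT_comp (mfi i)); exact: X_meas.
- by move=> i w _; exact: min_natr_ge0.
- by move=> w _ i j ij; exact: nondecreasing_min_natr.
Qed.

Lemma cvg_resolvent_min (f : 'rV[R]_n.+1 -> \bar R) x : measurable_fun setT f ->
  (forall y, 0 <= f y) ->
  resolvent X P D (i.+1%:R^-1)%R (fun y => Order.min (f y) (i%:R)%:E) x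
    @[i --> \oo] --> resolvent X P D 0 f x.
Proof.
move=> mf f0.
have mfi i : measurable_fun setT (fun y => Order.min (f y) (i%:R)%:E).
  exact: measurable_mine.
have fi0 i y : 0 <= Order.min (f y) (i%:R)%:E by exact: min_natr_ge0.
pose G (i : nat) (t : R) := (expR (- ((i.+1%:R^-1) * t)))%:E *
  killed X P D (fun y => Order.min (f y) (i%:R)%:E) t x.
have cG t : G i t @[i --> \oo] --> (expR (- (0 * t)))%:E * killed X P D f t x.
  apply: cvgeM; last exact: cvg_killed_min.
    by rewrite mule_defE eqe gt_eqF ?expR_gt0//= andbF.
  apply: cvg_EFin; first exact: nearW.
  apply: (@continuous_cvg _ _ _ _ _ _ expR); first exact: continuous_expR.
  apply: cvgN; apply: cvgM; last exact: cvg_cst.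
  exact: cvg_harmonic.
have mG i : measurable_fun setT (G i).
  exact: (measurable_resolvent_time P F_filtration).
have G0 i t : 0 <= G i t.
  by rewrite mule_ge0 ?killed_ge0// lee_fin expR_ge0.
have ndG t : {homo (fun i => G i t) : i j / (i <= j)%N >-> i <= j}.
  move=> i j ij; rewrite /G.
  have [t0|t0] := ltP t 0%R; first by rewrite !killed_neg// !mule0.
  apply: lee_pmul; rewrite ?killed_ge0 ?lee_fin ?expR_ge0//.
    rewrite ler_expR lerN2 ler_wpM2r// lef_pV2 ?posrE// ler_nat//.
  by apply: (le_killed P F_filtration) => // y; exact: nondecreasing_min_natr.
have := @cvg_monotone_convergence _ _ _ leb _ measurableT G.
rewrite (_ : \int[leb]_(t in _) limn _ = resolvent X P D 0 f x); last first.
  by apply: eq_integral => t _; apply/cvg_lim => //; exact: cG.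
by apply.
Qed.

Lemma killed_submarkov_resolvent : submarkov_resolvent (resolvent X P D).
Proof.
split.
- by move=> b f x; exact: resolvent_ge0.
- by move=> b f mf f0; exact: (measurable_resolvent P F_filtration).
- by move=> b f h x mf mh f0 fh; exact: (le_resolvent P F_filtration).
- by move=> a b f x ab mf f0; exact: (le_resolvent_rate P F_filtration).
- by move=> b f h x mf mh f0 h0; exact: (resolventD P F_filtration).
- by move=> b f k x mf f0 k0; exact: (resolventZ P F_filtration).
- by move=> b k x b0 k0; exact: (resolvent_cst_le P F_filtration).
- by move=> a b f x ab mf f0; exact: (resolvent_eq F_filtration).
- by move=> f x mf f0; exact: cvg_resolvent_min.
Qed.

End KilledResolvent.

(** * Exit times and the Green function *)

Section ExitTime.
Context {R : realType} {n : nat} {dO : measure_display}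
  {Omega : measurableType dO}.
Variable X : R -> Omega -> 'rV[R]_n.+1.
Hypothesis X_cont : forall w, {within [set t : R | 0 <= t], continuous (X ^~ w)}.
Hypothesis X_meas : forall t, 0 <= t -> measurable_fun setT (X t).
Variable D : set 'rV[R]_n.+1.
Hypothesis D_open : open D.

Lemma le_exit_time (T : R) w :
  (T%:E <= exit_time X D w)%E <-> forall r, 0 < r < T -> D (X r w).
Proof.
split => [h r /andP[r0 rT]|h].
  apply: contrapT => Dr; move: rT; apply/negP; rewrite -leNgt -lee_fin.
  by apply: le_trans h _; apply: ereal_inf_lbound; exists r.
apply: le_ereal_inf_tmp => _ [r [r0 Dr] <-]; rewrite lee_fin leNgt; apply/negP => rT.
by apply: Dr; apply: h; rewrite r0.
Qed.

Lemma exit_time_ge0 w : (0 <= exit_time X D w)%E.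
Proof. by apply/le_exit_time => r /andP[/lt_trans h /h]; rewrite ltxx. Qed.

Lemma measurable_stays (s l : R) : 0 <= s ->
  measurable [set w | forall r, 0 <= r <= l -> D (X (s + r) w)].
Proof.
move=> s0; have [l0|l0] := leP 0 l; last first.
  rewrite (_ : [set w | _] = setT)//; apply/seteqP; split => // w _ r /andP[r0 rl].
  by have := le_lt_trans (le_trans r0 rl) l0; rewrite ltxx.
have := @measurable_alive _ _ _ _ (fun r => X (s + r))
  (fun w => @shift_path_cont _ _ _ _ X X_cont s w s0)
  (fun t t0 => X_meas (addr_ge0 s0 t0)) D D_open l.
congr measurable; apply/seteqP; split => w; first by case.
by move=> h; split.
Qed.

(** The exit time is at least r when the path remains in D on each of the compact
    intervals [1/(j+1), r - 1/(j+1)]; time 0 is left out. *)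
Lemma measurable_exit_time : measurable_fun setT (exit_time X D).
Proof.
apply: (measurability _ (ErealGenInftyO.measurableE R)) => _ [_ [r ->] <-].
rewrite setTI (_ : _ @^-1` _ = ~` [set w | (r%:E <= exit_time X D w)%E]); last first.
  by apply/seteqP; split => w /=; rewrite in_itv/= ltNge => /negP.
apply: measurableC.
rewrite (_ : [set w | _] = \bigcap_j [set w | forall t, 0 <= t <= r - j.+1%:R^-1 - j.+1%:R^-1 ->
    D (X (j.+1%:R^-1 + t) w)]).
  by apply: bigcapT_measurable => j; exact: measurable_stays.
apply/seteqP; split => w /=; rewrite le_exit_time => h.
  move=> j _ t /andP[t0 tr]; apply: h; rewrite ltr_pwDl//=.
  by rewrite addrC -ltrBrDr (le_lt_trans tr)// ltrBlDr ltrDl.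
move=> t /andP[t0 tr].
pose e := Num.min t (r - t).
have e0 : 0 < e by rewrite lt_min t0 subr_gt0.
pose j := Num.truncn e^-1.
have je : j.+1%:R^-1 < e by rewrite invf_plt ?posrE// truncnS_gt.
have := h j I (t - j.+1%:R^-1); rewrite subrKC; apply; apply/andP; split.
  by rewrite subr_ge0 ltW// (lt_le_trans je)// ge_min lexx.
rewrite lerB// lerBrDl -lerBrDr.
by rewrite (le_trans (ltW je))// ge_min lexx orbT.
Qed.

Lemma before_exitE w : D (X 0 w) -> before_exit X D w = [set t | alive X D t w].
Proof.
move=> D0; apply/seteqP; split => t [t0].
  move=> tT; split => // r /andP[r0 rt].
  move: r0; rewrite le_eqVlt => /predU1P[<-//|r0].
  apply: contrapT => Dr; have : (exit_time X D w <= r%:E)%E.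
    by apply: ereal_inf_lbound; exists r.
  by rewrite leNgt (le_lt_trans _ tT).
move=> h; split => //.
have DX : nbhs (X t w) D by apply: open_nbhs_nbhs; split => //; apply: h; rewrite t0/=.
have /= [e /= e0 eD] := path_cvg (@X_cont w) t0 DX.
apply: (@lt_le_trans _ _ (t + e)%:E); first by rewrite lte_fin ltrDl.
apply/le_exit_time => r /andP[r0 rte].
have [rt|tr] := leP r t; first by apply: h; rewrite (ltW r0).
apply: eD; last exact: ltW.
by rewrite /= ltr0_norm ?subr_lt0// opprB ltrBlDl.
Qed.

Lemma measurable_before_exit :
  measurable [set p : R * Omega | before_exit X D p.2 p.1].
Proof.
rewrite (_ : [set p | _] = ([set t : R | 0 <= t] `*` setT) `&`
  [set p | (p.1%:E < exit_time X D p.2)%E]); last first.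
  by apply/seteqP; split => -[t w] /=; rewrite /before_exit/=; tauto.
apply: measurableI.
  apply: measurableX => //.
  by rewrite (_ : [set t : R | _] = `[0, +oo[%classic)//; apply/seteqP; split => t; rewrite /= in_itv/= andbT.
rewrite -[X in measurable X]setTI; apply: measurable_lte => //.
  exact/measurable_EFinP.
exact: (measurableT_comp measurable_exit_time measurable_snd).
Qed.

End ExitTime.

Section GreenResolvent.
Context {R : realType} {n : nat} {dO : measure_display}
  {Omega : measurableType dO}.
Variables (X : R -> Omega -> 'rV[R]_n.+1) (P : R.-pker 'rV[R]_n.+1 ~> Omega).
Hypothesis X_meas : forall t, 0 <= t -> measurable_fun setT (X t).
Hypothesis X_start : forall x, P x [set w | X 0 w = x] = 1%E.
Hypothesis X_cont : forall w, {within [set t : R | 0 <= t], continuous (X ^~ w)}.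
Variable D : set 'rV[R]_n.+1.
Hypothesis D_open : open D.
Notation leb := (@lebesgue_measure R).
Local Open Scope ereal_scope.

(** At rate 0 the resolvent is the expected occupation measure: a path that
    starts in D has not exited before t exactly when it has remained in D up to
    time t. *)
Lemma occupation_resolvent (f : 'rV[R]_n.+1 -> \bar R) x : D x ->
  measurable_fun setT f -> (forall y, 0 <= f y) ->
  \int[P x]_w \int[leb]_(t in before_exit X D w) f (X t w) =
  resolvent X P D 0 f x.
Proof.
move=> Dx mf f0.
have mX := jointly_measurable X_cont X_meas.
have mfX : measurable_fun setT (fun p : R * Omega => f (X (Num.max 0%R p.1) p.2)).
  exact: (measurableT_comp mf mX).
pose G (A : set (R * Omega)) (p : R * Omega) := (\1_A p)%:E * f (X (Num.max 0%R p.1) p.2).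
have mG A : measurable A -> measurable_fun setT (G A).
  by move=> mA; apply: emeasurable_funM => //; exact/measurable_EFinP/measurable_indic.
have G0 A p : 0 <= G A p by rewrite mule_ge0// lee_fin.
pose B := [set p : R * Omega | before_exit X D p.2 p.1].
pose A := [set p : R * Omega | alive X D p.1 p.2].
have mB : measurable B := measurable_before_exit X_cont X_meas D_open.
have mA : measurable A := measurable_alive2 X_cont X_meas D_open.
transitivity (\int[P x]_w \int[leb]_t G B (t, w)).
  apply: eq_integral => w _; rewrite integral_mkcond; apply: eq_integral => t _.
  rewrite /G patchE indicE.
  rewrite (_ : (_ \in B) = (t \in before_exit X D w)); last first.
    by apply/idP/idP; rewrite !inE.
  by case: ifPn => [|_]; rewrite ?mul0e// inE => -[t0 _]; rewrite mul1e max_r.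
transitivity (\int[P x]_w \int[leb]_t G A (t, w)).
  apply: ge0_ae_eq_integral => //.
  - by apply: (measurable_fun_fubini_tonelli_G (m1 := leb) (G B)) => //; exact: mG.
  - by apply: (measurable_fun_fubini_tonelli_G (m1 := leb) (G A)) => //; exact: mG.
  - by move=> w _; apply: integral_ge0.
  - by move=> w _; apply: integral_ge0.
  apply: filterS (start_ae X_meas X_start Dx) => w Dw _; apply: eq_integral => t _.
  rewrite /G !indicE; congr (_%:R%:E * _); congr nat_of_bool.
  by apply/idP/idP; rewrite !inE /B /A /= before_exitE.
rewrite -(fubini_tonelli (m1 := leb) (m2 := pker_prob P x) (G A))//; last exact: mG.
apply: eq_integral => t _.
by rewrite killedE// mul0r oppr0 expR0 mul1e.
Qed.

End GreenResolvent.

(** * Potentials of functions on D *)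

Section OpenDomain.
Context {R : realType} {n : nat}.

Lemma within_open_cvg {T : topologicalType} (D : set 'rV[R]_n.+1)
    (f : 'rV[R]_n.+1 -> T) x :
  open D -> {within D, continuous f} -> D x -> f y @[y --> x] --> f x.
Proof.
move=> oD cf Dx; have := cf x; rewrite /continuous_at /= => h U /h.
rewrite /nbhs/= -nbhs_subspace_in// within_interior//.
exact: open_nbhs_nbhs.
Qed.

Lemma open_within_preimage {T : topologicalType} (D : set 'rV[R]_n.+1)
    (f : 'rV[R]_n.+1 -> T) (U : set T) :
  open D -> {within D, continuous f} -> open U -> open (D `&` f @^-1` U).
Proof.
move=> oD cf oU; rewrite openE => x [Dx fUx].
apply: filterI; first exact: open_nbhs_nbhs.
by apply: (within_open_cvg oD cf Dx); exact: open_nbhs_nbhs.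
Qed.

Lemma within_continuous_measurable (D : set 'rV[R]_n.+1) (f : 'rV[R]_n.+1 -> R) :
  open D -> {within D, continuous f} -> measurable_fun D f.
Proof.
move=> oD cf; apply: (measurability _ (RGenOpens.measurableE R)) => _ [_ [a [b ->]] <-].
by apply: open_measurable_rV; apply: open_within_preimage => //; exact: interval_open.
Qed.

Lemma lebesgue_bounded_lty (m : {measure set 'rV[R]_n.+1 -> \bar R})
    (D : set 'rV[R]_n.+1) : is_lebesgue_measure m -> open D -> bounded_set D ->
  (m D < +oo)%E.
Proof.
move=> m_leb oD [M [Mreal DM]].
pose M' := Num.max M 0 + 1.
have DM' x : D x -> `|x| <= M'.
  by apply: DM; rewrite /M' (le_lt_trans (y := Num.max M 0)) ?le_max ?lexx// ltrDl.
have M'0 : 0 <= M' by rewrite addr_ge0// le_max lexx orbT.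
pose a : 'rV[R]_n.+1 := const_mx (- M' - 1); pose b : 'rV[R]_n.+1 := const_mx M'.
have mB : measurable [set x : 'rV[R]_n.+1 | forall i, a 0 i < x 0 i <= b 0 i].
  rewrite (_ : [set x | _] = \bigcap_(i in [set: 'I_n.+1])
     ([set x : 'rV[R]_n.+1 | a 0 i < x 0 i] `&` [set x : 'rV[R]_n.+1 | x 0 i <= b 0 i])); last first.
    apply/seteqP; split => x /= h i; first by move=> _; apply/andP; exact: h.
    by have [] := h i I; move=> /= -> ->.
  apply: fin_bigcap_measurable; first exact: finite_finset.
  move=> i _; apply: measurableI.
    apply: open_measurable_rV.
    apply: (@open_comp _ _ (fun x : 'rV[R]_n.+1 => x 0 i) [set y | a 0 i < y]).
      by move=> x _; exact: coord_continuous.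
    exact: open_gt.
  apply: closed_measurable_rV.
  apply: (@closed_comp _ _ (fun x : 'rV[R]_n.+1 => x 0 i) [set y | y <= b 0 i]).
    by move=> x _; exact: coord_continuous.
  exact: closed_le.
apply: (@le_lt_trans _ _ (m [set x | forall i, a 0 i < x 0 i <= b 0 i])).
  apply: le_measure; rewrite ?inE//; first exact: open_measurable_rV.
  move=> x /DM' xM i /=; rewrite !mxE.
  have xi : `|x 0 i| <= M'.
    apply: le_trans xM; rewrite (_ : `|x| = mx_norm x)// mx_normrE.
    exact: (le_bigmax _ (fun ij : 'I_1 * 'I_n.+1 => `|x ij.1 ij.2|) (0, i)).
  move: xi; rewrite ler_norml => /andP[h1 ->]; rewrite andbT.
  by apply: lt_le_trans h1; rewrite ltrBlDr ltrDl.
rewrite m_leb ?ltry// => i; rewrite !mxE.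
by rewrite (@le_trans _ _ 0)// subr_le0 (@le_trans _ _ 0)// oppr_le0.
Qed.

End OpenDomain.

Section Potential.
Context {R : realType} {n : nat}.
Variables (m : {measure set 'rV[R]_n.+1 -> \bar R}) (D : set 'rV[R]_n.+1).
Hypothesis D_open : open D.
Hypothesis D_fin : (m D < +oo)%E.
Local Open Scope ereal_scope.

Let mD : measurable D := open_measurable_rV D_open.
Let mr : {finite_measure set 'rV[R]_n.+1 -> \bar R} := mfrestr mD D_fin.

Lemma integral_mfrestr (f : 'rV[R]_n.+1 -> \bar R) :
  measurable_fun setT f -> (forall y, 0 <= f y) ->
  \int[mr]_x f x = \int[m]_(x in D) f x.
Proof.
move=> mf f0.
pose i : {mfun 'rV[R]_n.+1 >-> 'rV[R]_n.+1} := mfun_Sub (mem_set (@measurable_id _ 'rV[R]_n.+1 setT)).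
rewrite -[RHS](ge0_integral_pushforward_restr m mD i mf f0).
by apply: eq_measure_integral => A mA _.
Qed.

Lemma fubini_tonelli_in (k : 'rV[R]_n.+1 * 'rV[R]_n.+1 -> \bar R) :
  measurable_fun setT k -> (forall p, 0 <= k p) ->
  \int[m]_(x in D) \int[m]_(y in D) k (x, y) =
  \int[m]_(y in D) \int[m]_(x in D) k (x, y).
Proof.
move=> mk k0.
have m1 x : measurable_fun setT (fun y => k (x, y)).
  exact: (measurableT_comp mk (measurable_pair1 x)).
have m2 y : measurable_fun setT (fun x => k (x, y)).
  exact: (measurableT_comp mk (measurable_pair2 y)).
under eq_integral do rewrite -integral_mfrestr//.
under [RHS]eq_integral do rewrite -integral_mfrestr//.
rewrite -integral_mfrestr; last 2 first.
- exact: (measurable_fun_fubini_tonelli_F (m2 := mr) k).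
- by move=> x; apply: integral_ge0.
rewrite -integral_mfrestr; last 2 first.
- exact: (measurable_fun_fubini_tonelli_G (m1 := mr) k).
- by move=> x; apply: integral_ge0.
exact: (fubini_tonelli (m1 := mr) (m2 := mr) k).
Qed.

Lemma measurable_integral_in (k : 'rV[R]_n.+1 * 'rV[R]_n.+1 -> \bar R) :
  measurable_fun setT k -> (forall p, 0 <= k p) ->
  measurable_fun setT (fun x => \int[m]_(y in D) k (x, y)).
Proof.
move=> mk k0.
have m1 x : measurable_fun setT (fun y => k (x, y)).
  exact: (measurableT_comp mk (measurable_pair1 x)).
under eq_fun do rewrite -integral_mfrestr//.
exact: (measurable_fun_fubini_tonelli_F (m2 := mr) k).
Qed.

Variable g : 'rV[R]_n.+1 -> 'rV[R]_n.+1 -> \bar R.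
Hypothesis g_meas : measurable_fun (D `*` D)
  (fun p : 'rV[R]_n.+1 * 'rV[R]_n.+1 => g p.1 p.2).
Hypothesis g_ge0 : forall x y, D x -> D y -> 0 <= g x y.
Hypothesis g_sym : forall x y, D x -> D y -> g x y = g y x.
Implicit Types F E : 'rV[R]_n.+1 -> R.

Definition potential F x : \bar R := \int[m]_(y in D) (g x y * (F y)%:E).

(** The kernel g extended by 0 outside D x D. *)
Let g0 := (fun p : 'rV[R]_n.+1 * 'rV[R]_n.+1 => g p.1 p.2) \_ (D `*` D).

Let measurable_g0 : measurable_fun setT g0.
Proof. by apply/(measurable_restrictT _ (measurableX mD mD)). Qed.

Let g0_ge0 p : 0 <= g0 p.
Proof.
rewrite /g0 patchE; case: ifPn => //; rewrite inE => -[? ?]; exact: g_ge0.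
Qed.

Let g0E x y : D x -> D y -> g0 (x, y) = g x y.
Proof. by move=> Dx Dy; rewrite /g0 patchE mem_set. Qed.

Lemma potentialE F x : D x ->
  potential F x = \int[m]_(y in D) (g0 (x, y) * (F y)%:E).
Proof.
by move=> Dx; apply: eq_integral => y; rewrite inE => Dy; rewrite g0E.
Qed.

Lemma potential_ge0 F x : D x -> (forall y, (0 <= F y)%R) -> 0 <= potential F x.
Proof.
by move=> Dx F0; apply: integral_ge0 => y Dy; rewrite mule_ge0 ?g_ge0// lee_fin.
Qed.

Let measurable_kernel_fun F : measurable_fun setT F ->
  measurable_fun setT (fun p : 'rV[R]_n.+1 * 'rV[R]_n.+1 => g0 p * (F p.2)%:E).
Proof.
move=> mF; apply: emeasurable_funM => //; apply/measurable_EFinP.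
exact: (measurableT_comp mF measurable_snd).
Qed.

Lemma measurable_potential F : measurable_fun setT F -> (forall y, (0 <= F y)%R) ->
  measurable_fun D (potential F).
Proof.
move=> mF F0; apply: (eq_measurable_fun
   (fun x => \int[m]_(y in D) (g0 (x, y) * (F y)%:E))).
  by move=> x; rewrite inE => Dx; rewrite potentialE.
apply: measurable_funTS.
apply: (measurable_integral_in (measurable_kernel_fun mF)).
by move=> p; rewrite mule_ge0// lee_fin.
Qed.

Lemma potential_symmetric F E : measurable_fun setT F -> measurable_fun setT E ->
  (forall y, (0 <= F y)%R) -> (forall y, (0 <= E y)%R) ->
  \int[m]_(x in D) ((F x)%:E * potential E x) =
  \int[m]_(x in D) ((E x)%:E * potential F x).
Proof.
move=> mF mE F0 E0.
have mg1 x : measurable_fun setT (fun y => g0 (x, y)).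
  exact: (measurableT_comp measurable_g0 (measurable_pair1 x)).
have H (A B : 'rV[R]_n.+1 -> R) : measurable_fun setT A -> measurable_fun setT B ->
    (forall y, (0 <= A y)%R) -> (forall y, (0 <= B y)%R) ->
    \int[m]_(x in D) ((A x)%:E * potential B x) =
    \int[m]_(x in D) \int[m]_(y in D) ((A x)%:E * (g0 (x, y) * (B y)%:E)).
  move=> mA mB A0 B0; apply: eq_integral => x; rewrite inE => Dx.
  rewrite potentialE// ge0_integralZl//.
  - apply: emeasurable_funM; first exact: measurable_funTS.
    by apply/measurable_EFinP; exact: measurable_funTS.
  - by move=> y _; rewrite mule_ge0// lee_fin.
  - by rewrite lee_fin.
apply: (etrans (H F E mF mE F0 E0)); apply: (etrans _ (esym (H E F mE mF E0 F0))).
transitivity (\int[m]_(y in D) \int[m]_(x in D) ((F x)%:E * (g0 (x, y) * (E y)%:E))).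
  apply: (fubini_tonelli_in (k := fun p => (F p.1)%:E * (g0 p * (E p.2)%:E))).
    apply: emeasurable_funM; last exact: measurable_kernel_fun.
    by apply/measurable_EFinP; exact: (measurableT_comp mF measurable_fst).
  by move=> p; rewrite !mule_ge0// lee_fin.
apply: eq_integral => y; rewrite inE => Dy; apply: eq_integral => x.
by rewrite inE => Dx; rewrite !g0E// (g_sym Dx Dy) [LHS]muleC [LHS]muleAC [LHS]muleC.
Qed.

End Potential.

Section GreenPotential.
Context {R : realType} {n : nat} {dO : measure_display}
  {Omega : measurableType dO}.
Variables (X : R -> Omega -> 'rV[R]_n.+1) (P : R.-pker 'rV[R]_n.+1 ~> Omega)
  (F : R -> set (set Omega)).
Hypothesis F_filtration : is_filtration F.
Hypothesis X_adapted : forall t (B : set 'rV[R]_n.+1),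
  0 <= t -> measurable B -> F t (X t @^-1` B).
Hypothesis X_start : forall x, P x [set w | X 0 w = x] = 1%E.
Hypothesis X_cont : forall w, {within [set t : R | 0 <= t], continuous (X ^~ w)}.
Hypothesis X_markov : strong_markov X P F.
Variables (m : {measure set 'rV[R]_n.+1 -> \bar R}) (D : set 'rV[R]_n.+1).
Hypothesis D_open : open D.
Hypothesis D_fin : (m D < +oo)%E.
Variable g : 'rV[R]_n.+1 -> 'rV[R]_n.+1 -> \bar R.
Hypothesis g_green : is_green_function m D X P g.
Local Open Scope ereal_scope.
Implicit Types f h : 'rV[R]_n.+1 -> R.

Let mD : measurable D := open_measurable_rV D_open.
Let X_meas := process_measurable F_filtration X_adapted.

Lemma potential_resolvent f x : D x -> measurable_fun setT f ->
  (forall y, (0 <= f y)%R) ->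
  potential m D g f x = resolvent X P D 0 (EFin \o f) x.
Proof.
move=> Dx mf f0; rewrite /potential (green_occupation g_green)//.
rewrite (occupation_resolvent X_meas X_start X_cont D_open (f := EFin \o f))//.
exact/measurable_EFinP.
Qed.

Let g_ge0 := green_ge0 g_green.
Let g_meas := green_measurable g_green.
Let g_sym := green_symmetric g_green.

Lemma green_section_measurable x : D x -> measurable_fun D (g x).
Proof.
move=> Dx; have mp : measurable_fun D (fun y : 'rV[R]_n.+1 => (x, y)).
  by apply: measurable_funTS; exact: measurable_pair1.
apply: (measurable_comp (measurableX mD mD) _ g_meas mp).
by move=> _ [y Dy <-].
Qed.

Lemma le_potential f h x : D x -> measurable_fun D f -> measurable_fun D h ->
  (forall y, D y -> (0 <= f y)%R) -> (forall y, D y -> (f y <= h y)%R) ->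
  potential m D g f x <= potential m D g h x.
Proof.
move=> Dx mf mh f0 fh; have mg := green_section_measurable Dx.
apply: ge0_le_integral => //.
- by move=> y Dy; rewrite mule_ge0 ?g_ge0// lee_fin f0.
- by apply: emeasurable_funM => //; exact/measurable_EFinP.
- by apply: emeasurable_funM => //; exact/measurable_EFinP.
- by move=> y Dy; rewrite lee_wpmul2l ?g_ge0// lee_fin fh.
Qed.

Lemma potential_one_lty x : D x -> potential m D g (fun=> 1%R) x < +oo.
Proof.
move=> Dx; rewrite /potential; under eq_integral do rewrite mule1.
exact: (green_finite g_green).
Qed.

Lemma delta_potential x : D x ->
  (delta m D g x)%:E = potential m D g (fun=> 1%R) x.
Proof.
move=> Dx; rewrite /delta /green_operator fineK// ge0_fin_numE.
  exact: potential_one_lty.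
by apply: potential_ge0.
Qed.

Lemma delta_ge0 x : D x -> (0 <= delta m D g x)%R.
Proof. by move=> Dx; rewrite -lee_fin delta_potential//; exact: potential_ge0. Qed.

Lemma indic_potential_lty B x : D x -> measurable B ->
  potential m D g \1_B x < +oo.
Proof.
move=> Dx mB; apply: le_lt_trans (potential_one_lty Dx).
by apply: le_potential.
Qed.

Lemma green_operator_indic B x : D x -> measurable B ->
  (green_operator m D g \1_B x)%:E = potential m D g \1_B x.
Proof.
move=> Dx mB; rewrite /green_operator fineK// ge0_fin_numE.
  exact: indic_potential_lty.
by apply: potential_ge0.
Qed.

(** The domination principle for potentials: the exceptional null set is moved
    out of [f], which does not change its potential. *)
Lemma potential_domination f h : measurable_fun setT f -> measurable_fun setT h ->
  (forall y, (0 <= f y)%R) -> (forall y, (0 <= h y)%R) ->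
  (forall y, ~ D y -> f y = 0%R) ->
  {ae m, forall y, D y -> (0 < f y)%R -> potential m D g f y <= potential m D g h y} ->
  forall x, D x -> potential m D g f x <= potential m D g h x.
Proof.
move=> mf mh f0 h0 fD ae_fh.
pose A := D `&` [set y | potential m D g f y <= potential m D g h y].
have mpf := measurable_potential D_open D_fin g_meas g_ge0 mf f0.
have mph := measurable_potential D_open D_fin g_meas g_ge0 mh h0.
have mA : measurable A by exact: measurable_lee.
pose f' y := (f y * \1_A y)%R.
have mf' : measurable_fun setT f' by apply: measurable_funM => //; exact: measurable_indic.
have f'0 y : (0 <= f' y)%R by rewrite mulr_ge0.
have pf' x : D x -> potential m D g f' x = potential m D g f x.
  move=> Dx; have mg := green_section_measurable Dx.
  have mfh k : measurable_fun setT k -> measurable_fun D (fun y => g x y * (k y)%:E).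
    move=> mk; apply: emeasurable_funM => //.
    by apply/measurable_EFinP; exact: measurable_funTS.
  apply: ge0_ae_eq_integral => //.
  - exact: mfh.
  - exact: mfh.
  - by move=> y Dy; rewrite mule_ge0 ?g_ge0// lee_fin.
  - by move=> y Dy; rewrite mule_ge0 ?g_ge0// lee_fin.
  apply: filterS ae_fh => y hy Dy; rewrite /f' indicE.
  case: (boolP (y \in A)) => yA; first by rewrite mulr1.
  rewrite mulr0; have [fy|fy] := ltP 0%R (f y).
    by move/negP: yA; case; rewrite inE; split => //; exact: hy.
  by rewrite (_ : f y = 0%R)//; apply/eqP; rewrite eq_le fy f0.
move=> x Dx; rewrite -pf'// !potential_resolvent//.
apply: (domination (killed_submarkov_resolvent F_filtration X_adapted X_start
  X_cont X_markov D_open)) => //.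
- exact/measurable_EFinP.
- exact/measurable_EFinP.
move=> y; rewrite /= lte_fin /f' indicE => f'y.
have yA : y \in A by apply: contraTT f'y => /negPf ->; rewrite mulr0 ltxx.
have [Dy hy] := set_mem yA.
by rewrite -!potential_resolvent// pf'.
Qed.

(** By symmetry the integral of the potential of f over D is that of f against
    the potential of 1. *)
Lemma potential_integrable f : measurable_fun setT f -> (forall y, (0 <= f y)%R) ->
  m.-integrable D (fun x => (f x * delta m D g x)%:E) ->
  m.-integrable D (potential m D g f).
Proof.
move=> mf f0 /integrableP[_ fdelta]; apply/integrableP; split.
  exact: (measurable_potential D_open D_fin g_meas g_ge0).
rewrite (_ : \int[m]_(x in D) _ = \int[m]_(x in D) `|(f x * delta m D g x)%:E|)//.
transitivity (\int[m]_(x in D) (1%:E * potential m D g f x)).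
  apply: eq_integral => x; rewrite inE => Dx.
  by rewrite mul1e gee0_abs// potential_ge0.
transitivity (\int[m]_(x in D) ((f x)%:E * potential m D g (fun=> 1%R) x)).
  exact: (potential_symmetric D_open D_fin g_meas g_ge0 g_sym (F := fun=> 1%R)).
apply: eq_integral => x; rewrite inE => Dx.
by rewrite gee0_abs ?lee_fin ?mulr_ge0 ?delta_ge0// EFinM delta_potential.
Qed.

Lemma integral_potential_indic f B : measurable_fun setT f ->
  (forall y, (0 <= f y)%R) -> measurable B -> B `<=` D ->
  \int[m]_(x in B) potential m D g f x =
  \int[m]_(x in D) (f x * green_operator m D g \1_B x)%:E.
Proof.
move=> mf f0 mB BD.
transitivity (\int[m]_(x in D) ((\1_B x)%:E * potential m D g f x)).
  rewrite -[in LHS](setIidr BD) integral_mkcondr; apply: eq_integral => x _.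
  by rewrite patchE indicE; case: ifP; rewrite ?mul1e ?mul0e.
transitivity (\int[m]_(x in D) ((f x)%:E * potential m D g \1_B x)).
  by apply: (potential_symmetric D_open D_fin g_meas g_ge0 g_sym).
by apply: eq_integral => x; rewrite inE => Dx; rewrite EFinM green_operator_indic.
Qed.

Lemma green_operator_measurable B : measurable B ->
  measurable_fun D (green_operator m D g \1_B).
Proof.
move=> mB; apply: within_continuous_measurable => //.
apply: (green_continuous g_green); split; first exact: measurable_indic.
by exists 1%R => x _; rewrite indicE ger0_norm// lern1 leq_b1.
Qed.

Lemma green_operator_indic_le B x : D x -> measurable B ->
  (0 <= green_operator m D g \1_B x <= delta m D g x)%R.
Proof.
move=> Dx mB; rewrite -!lee_fin green_operator_indic// delta_potential//.
by rewrite potential_ge0//=; apply: le_potential.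
Qed.

Lemma integrable_green_indic f B : measurable B ->
  measurable_fun D f -> m.-integrable D (fun x => (f x * delta m D g x)%:E) ->
  m.-integrable D (fun x => (f x * green_operator m D g \1_B x)%:E).
Proof.
move=> mB mf; apply: le_integrable => //.
  apply/measurable_EFinP; apply: measurable_funM => //.
  exact: green_operator_measurable.
move=> x Dx; have /andP[h0 h1] := green_operator_indic_le Dx mB.
rewrite lee_fin !normrM ler_wpM2l// ger0_norm// ger0_norm//.
exact: le_trans h1.
Qed.

(** The analytic core of the uniqueness proof. Testing with indicators shows
    that [w] is the difference of the potentials of the positive and negative
    parts of [h]; the first of them is dominated by the second where [h > 0],
    hence everywhere, and conversely. *)
Lemma very_weak_solution_eq0 (w h : 'rV[R]_n.+1 -> R) :
  m.-integrable D (EFin \o w) -> measurable_fun D h ->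
  m.-integrable D (fun x => (h x * delta m D g x)%:E) ->
  (forall B, measurable B -> B `<=` D ->
    \int[m]_(x in D) (w x * \1_B x) =
    \int[m]_(x in D) (h x * green_operator m D g \1_B x))%R ->
  (forall x, D x -> (0 < h x -> w x <= 0)%R) ->
  (forall x, D x -> (h x < 0 -> 0 <= w x)%R) ->
  {ae m, forall x, D x -> w x = 0%R}.
Proof.
move=> iw mh ih test hpos hneg.
pose part (k : 'rV[R]_n.+1 -> R) : 'rV[R]_n.+1 -> R :=
  (fun x => Num.max (k x) 0%R : R) \_ D.
have part_ge0 k x : (0 <= part k x)%R.
  by rewrite /part patchE; case: ifP => // _; rewrite le_max lexx orbT.
have partE k x : D x -> part k x = Num.max (k x) 0%R.
  by move=> Dx; rewrite /part patchE mem_set.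
have part_out k x : ~ D x -> part k x = 0%R.
  by move=> Dx; rewrite /part patchE memNset.
have mpart (k : 'rV[R]_n.+1 -> R) : measurable_fun D k -> measurable_fun setT (part k).
  by move=> mk; apply/(measurable_restrictT _ mD); exact: measurable_maxr.
have ipart (k : 'rV[R]_n.+1 -> R) : measurable_fun D k ->
    m.-integrable D (fun x => (k x * delta m D g x)%:E) ->
    m.-integrable D (fun x => (part k x * delta m D g x)%:E).
  move=> mk ik; apply: le_integrable ik => //.
    apply/measurable_EFinP; apply: measurable_funM.
      by apply: measurable_funTS; exact: mpart.
    apply: within_continuous_measurable => //; apply: (green_continuous g_green).
    by split => //; exists 1%R => x _; rewrite normr1.
  move=> x Dx; rewrite lee_fin !normrM ler_wpM2r// partE// ger0_norm.
    by rewrite ge_max ler_norm normr_ge0.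
  by rewrite le_max lexx orbT.
pose f1 := part h; pose f2 := part (fun x => - h x)%R.
have mh' : measurable_fun D (fun x => - h x)%R by exact: measurable_funN.
have ih' : m.-integrable D (fun x => (- h x * delta m D g x)%:E).
  have := integrableN ih; apply: eq_integrable => // x _ /=.
  by rewrite mulNr.
have mf1 := mpart _ mh; have mf2 := mpart _ mh'.
have if1 := ipart _ mh ih; have if2 := ipart _ mh' ih'.
have hE x : D x -> h x = (f1 x - f2 x)%R.
  move=> Dx; rewrite /f1 /f2 !partE//.
  have [h0|h0] := leP 0%R (h x).
    by rewrite max_r ?subr0// oppr_le0.
  by rewrite max_l ?sub0r ?opprK// oppr_ge0 ltW.
have iV1 := potential_integrable mf1 (part_ge0 _) if1.
have iV2 := potential_integrable mf2 (part_ge0 _) if2.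
have wE : ae_eq m D (EFin \o w)
    (fun x => potential m D g f1 x - potential m D g f2 x).
  apply: integral_ae_eq => //.
    by apply: (measurable_int m); exact: integrableB.
  move=> E ED mE.
  have iwE : m.-integrable D (fun x => (w x * \1_E x)%:E).
    apply: (le_integrable mD _ _ iw) => //.
      apply/measurable_EFinP; apply: measurable_funM; last exact: measurable_indic.
      by apply/measurable_EFinP; exact: (measurable_int m iw).
    move=> x _; rewrite lee_fin normrM ler_piMr// indicE ger0_norm//.
    by rewrite lern1 leq_b1.
  have ihE := integrable_green_indic mE mh ih.
  have i1E := integrable_green_indic mE (measurable_funTS mf1) if1.
  have i2E := integrable_green_indic mE (measurable_funTS mf2) if2.
  transitivity (\int[m]_(x in D) (w x * \1_E x)%:E).
    rewrite -[in LHS](setIidr ED) integral_mkcondr; apply: eq_integral => x _.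
    rewrite patchE indicE; case: ifP; by rewrite ?mulr1 ?mulr0.
  rewrite -[LHS]fineK; last exact: integrable_fin_num.
  have := test E mE ED; rewrite /Rintegral => ->.
  rewrite fineK; last exact: integrable_fin_num.
  transitivity (\int[m]_(x in D) ((f1 x * green_operator m D g \1_E x)%:E -
     (f2 x * green_operator m D g \1_E x)%:E)).
    apply: eq_integral => x; rewrite inE => Dx.
    by rewrite hE// mulrBl EFinB.
  have iVE k := @integrableS _ _ R m _ _ k mD mE ED.
  apply: (etrans (integralB mD i1E i2E)).
  apply: (etrans _ (esym (integralB mE (iVE _ iV1) (iVE _ iV2)))).
  by congr (_ - _); apply/esym; exact: integral_potential_indic.
have dom (k1 k2 : 'rV[R]_n.+1 -> R) (s : R) : measurable_fun D k1 ->
    measurable_fun D k2 ->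
    (forall x, D x -> (0 < k1 x -> s * w x <= 0)%R) ->
    m.-integrable D (potential m D g (part k1)) ->
    m.-integrable D (potential m D g (part k2)) ->
    {ae m, forall x, D x -> (s * w x)%:E =
       potential m D g (part k1) x - potential m D g (part k2) x} ->
    forall x, D x -> potential m D g (part k1) x <= potential m D g (part k2) x.
  move=> mk1 mk2 k1w i1 i2 sw.
  apply: potential_domination => //.
  - exact: mpart.
  - exact: mpart.
  - exact: part_out.
  apply: filterS3 sw (integrable_ae mD i1) (integrable_ae mD i2) => x + + + Dx.
  move=> /(_ Dx) e /(_ Dx) fi1 /(_ Dx) fi2 k1x.
  rewrite -sube_le0 -e lee_fin; apply: k1w => //; move: k1x; rewrite partE//.
  by rewrite lt_max ltxx orbF.
have d12 x : D x -> potential m D g f1 x <= potential m D g f2 x.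
  apply: (dom h (fun x => - h x)%R 1%R) => //.
    by move=> y Dy; rewrite mul1r; exact: hpos.
  by apply: filterS wE => y h1 Dy; rewrite mul1r -h1.
have d21 x : D x -> potential m D g f2 x <= potential m D g f1 x.
  apply: (dom (fun x => - h x)%R h (-1)%R) => //.
    by move=> y Dy; rewrite oppr_gt0 mulN1r oppr_le0; exact: hneg.
  apply: filterS3 wE (integrable_ae mD iV1) (integrable_ae mD iV2) => y + + + Dy.
  move=> /(_ Dy) e /(_ Dy) fi1 /(_ Dy) fi2.
  transitivity (- (EFin \o w) y); first by rewrite mulN1r.
  by rewrite e fin_num_oppeB// addeC.
apply: filterS2 wE (integrable_ae mD iV2) => x h1 h2 Dx.
apply: EFin_inj; rewrite -[LHS]/((EFin \o w) x) h1//.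
have -> : potential m D g f1 x = potential m D g f2 x.
  by apply/eqP; rewrite eq_le d12// d21.
by rewrite subee// h2.
Qed.

End GreenPotential.

(** * The Martin boundary *)

Section MartinMetric.
Context {R : realType} {n : nat} {dO : measure_display}
  {Omega : measurableType dO}.
Variables (X : R -> Omega -> 'rV[R]_n.+1) (P : R.-pker 'rV[R]_n.+1 ~> Omega).
Hypothesis X_meas : forall t, 0 <= t -> measurable_fun setT (X t).
Hypothesis X_start : forall x, P x [set w | X 0 w = x] = 1%E.
Hypothesis X_cont : forall w, {within [set t : R | 0 <= t], continuous (X ^~ w)}.
Variables (m : {measure set 'rV[R]_n.+1 -> \bar R}) (D : set 'rV[R]_n.+1).
Hypothesis D_open : open D.
Variable g : 'rV[R]_n.+1 -> 'rV[R]_n.+1 -> \bar R.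
Hypothesis g_green : is_green_function m D X P g.
Notation leb := (@lebesgue_measure R).

Let mD : measurable D := open_measurable_rV D_open.

(** The paths started inside the open set D stay in D for a positive time, so
    their occupation time of D does not vanish almost surely. *)
Lemma delta_gt0 x : D x -> 0 < delta m D g x.
Proof.
move=> Dx; rewrite lt_neqAle (delta_ge0 g_green)// andbT; apply/eqP => d0.
pose A := [set p : R * Omega | alive X D p.1 p.2].
have mA : measurable A := measurable_alive2 X_cont X_meas D_open.
have mG : measurable_fun setT (fun p => (\1_A p)%:E : \bar R).
  exact/measurable_EFinP/measurable_indic.
have G0 p : (0 <= (\1_A p)%:E :> \bar R)%E by rewrite lee_fin.
have L0 : (\int[P x]_w \int[leb]_t (\1_A (t, w))%:E = 0)%E.
  rewrite -(fubini_tonelli (m1 := leb) (m2 := pker_prob P x) _ mG G0).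
  transitivity (resolvent X P D 0 (EFin \o (fun=> 1)) x).
    apply: eq_integral => t _; rewrite mul0r oppr0 expR0 mul1e killedE.
    by apply: eq_integral => w _; rewrite mule1.
  rewrite -(occupation_resolvent X_meas X_start X_cont D_open)//; last first.
    exact: measurable_cst.
  rewrite -(green_occupation g_green (eta := fun=> 1))//.
  by rewrite -[LHS](delta_potential g_green)// -d0.
have aeL : {ae P x, forall w, (\int[leb]_t (\1_A (t, w))%:E = 0 :> \bar R)%E}.
  have mL := measurable_fun_fubini_tonelli_G (m1 := leb) _ mG G0.
  have := (ae_eq_integral_abs (P x) measurableT mL).1; rewrite /fubini_G.
  under eq_integral do rewrite gee0_abs ?integral_ge0//.
  by move=> /(_ L0); apply: filterS => w; apply.
have : {ae P x, forall w, False}.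
  apply: filterS2 aeL (start_ae X_meas X_start Dx) => w Lw0 Dw.
  have /= [e /= e0 eD] := path_cvg (@X_cont w) (lexx 0)
    (open_nbhs_nbhs (conj D_open Dw)).
  have : (0 < \int[leb]_t (\1_A (t, w))%:E :> \bar R)%E; last by rewrite Lw0 ltxx.
  apply: (@lt_le_trans _ _ (\int[leb]_t (\1_(`[0, e / 2]%classic : set R) t)%:E)%E).
    rewrite integral_indic// setIT.
    apply: (@lt_le_trans _ _ (e / 2)%:E); first by rewrite lte_fin divr_gt0.
    rewrite le_eqVlt; apply/orP; left; apply/eqP/esym.
    apply: (etrans (lebesgue_measure_itv `[0%R, e / 2])).
    by rewrite /= lte_fin divr_gt0// -EFinB subr0.
  apply: ge0_le_integral => //.
  - exact/measurable_EFinP/measurable_indic.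
  - exact: (measurableT_comp mG (measurable_pair2 w)).
  move=> t _; rewrite lee_fin !indicE ler_nat.
  have [|] := boolP (t \in `[0, e / 2]%classic) => // /set_mem/=.
  rewrite in_itv/= => /andP[t0 te]; rewrite mem_set// /A/=; split => // r /andP[r0 rt].
  apply: eD => //=; rewrite sub0r normrN ger0_norm// (le_lt_trans rt)//.
  by rewrite (le_lt_trans te)// ltr_pdivrMr// mulr_natr mulr2n ltrDl.
move=> [N [mN PN0 /(_ _ _)NT]].
have : P x setT = 0%E.
  by rewrite (_ : setT = N)//; apply/seteqP; split => // w _; apply: NT => /=.
by rewrite (prob_kernel (s := P) x) => -[] /eqP; rewrite oner_eq0.
Qed.


Lemma C0_bounded_borel f : C0 D f -> bounded_borel D f.
Proof.
move=> [cf /(_ 1 ltr01) K]; split; first exact: within_continuous_measurable.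
have /continuous_compact-/(_ K) : {within D `&` [set x | 1 <= `|f x|], continuous f}.
  exact: continuous_subspaceW cf.
move=> /compact_bounded[M [_ KM]].
exists (Num.max 1 (M + 1)) => x Dx; rewrite le_max.
have [f1|f1] := leP 1 `|f x|; last by rewrite (ltW f1).
by rewrite orbC; apply/orP; left; apply: (KM (M + 1)); [rewrite ltrDl|exists x].
Qed.

Lemma bounded_borel_cst c : bounded_borel D (fun=> c : R).
Proof. by split => //; exists `|c|. Qed.

Let green_integrable x eta : D x -> bounded_borel D eta ->
  m.-integrable D (fun y => g x y * (eta y)%:E)%E.
Proof.
move=> Dx [meta [M etaM]].
have mg := green_section_measurable D_open g_green Dx.
have ig : m.-integrable D (g x).
  apply/integrableP; split => //.
  rewrite (eq_integral (g x)); first exact: (green_finite g_green).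
  by move=> y /set_mem Dy; rewrite gee0_abs// (green_ge0 g_green).
apply: (le_integrable mD _ _ (integrableZl mD `|M| ig)).
  by apply: emeasurable_funM => //; exact/measurable_EFinP.
move=> y Dy; rewrite !abseM muleC; apply: lee_pmul => //.
by rewrite lee_fin normr_id (le_trans (etaM y Dy))// ler_norm.
Qed.

Lemma kappa_hatE f y : D y -> bounded_borel D f ->
  kappa_hat m D g f y = (delta m D g y)^-1 * green_operator m D g f y.
Proof.
move=> Dy bf; rewrite /kappa_hat /green_operator.
rewrite (_ : integral _ _ _ =
    ((delta m D g y)^-1%:E * \int[m]_(x in D) (g y x * (f x)%:E))%E).
  by rewrite fineM//; exact/integrable_fin_num/green_integrable.
rewrite -integralZl//; last exact: green_integrable.
apply: eq_integral => x; rewrite inE => Dx.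
by rewrite /kappa (green_symmetric g_green Dx Dy) muleAC muleC.
Qed.

(** By the symmetry of g this is the quotient of the potentials of f and of 1. *)
Lemma kappa_hat_cvg f x : bounded_borel D f -> D x ->
  kappa_hat m D g f y @[y --> x] --> kappa_hat m D g f x.
Proof.
move=> bf Dx; rewrite kappa_hatE//.
have cg e (be : bounded_borel D e) :=
  within_open_cvg D_open (green_continuous g_green be) Dx.
have : nbhs x D by exact: open_nbhs_nbhs.
move: (cg _ (bounded_borel_cst 1)) (cg _ bf).
move: (nbhs x) (nbhs_filter x) => G GF cd cf GD.
have dV := @cvgV _ _ G GF _ _ (lt0r_neq0 (delta_gt0 Dx)) cd.
apply: cvg_trans (@cvgM _ _ G GF _ _ _ _ dV cf); apply: near_eq_cvg.
by apply: (@filterS _ G GF _ _ _ GD) => y Dy; rewrite kappa_hatE.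
Qed.

Lemma kappa_hat_measurable f : bounded_borel D f ->
  measurable_fun D (kappa_hat m D g f).
Proof.
move=> bf; apply: within_continuous_measurable => //.
by apply: continuous_in_subspaceT => x /set_mem; exact: kappa_hat_cvg.
Qed.

Variable phi : nat -> 'rV[R]_n.+1 -> R.
Hypothesis phi_bounded : forall k, bounded_borel D (phi k).

Definition martin_partial N x y : R := series (fun k =>
  let r := `|kappa_hat m D g (phi k) x - kappa_hat m D g (phi k) y| in
  2^-1 ^+ k.+1 * (r / (1 + r))) N.

Let frac01 (r : R) : 0 <= r -> 0 <= r / (1 + r) <= 1.
Proof.
move=> r0; rewrite divr_ge0 ?addr_ge0//= ler_pdivrMr ?ltr_pwDl// mul1r.
by rewrite lerDr.
Qed.

Let continuous_frac : continuous (fun r : R => `|r| / (1 + `|r|)).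
Proof.
move=> r; apply: cvgM; first exact: norm_continuous.
apply: cvgV; first by rewrite gt_eqF// ltr_pwDl.
by apply: cvgD; [exact: cvg_cst|exact: norm_continuous].
Qed.

Lemma martin_partial_le x y N j : 
  martin_partial N x y <= martin_partial (N + j) x y <=
  martin_partial N x y + 2^-1 ^+ N - 2^-1 ^+ (N + j).
Proof.
elim: j => [|j IH]; first by rewrite addn0 addrK !lexx.
rewrite addnS; have /andP[h1 h2] := IH.
rewrite [martin_partial (N + j).+1 x y]seriesSr -/(martin_partial _ _ _) exprS.
set r := `|_|; have /andP[r0 r1] := frac01 (normr_ge0 _ : 0 <= r).
have p0 : 0 <= 2^-1 ^+ (N + j) :> R by rewrite exprn_ge0.
cbv zeta; apply/andP; split.
  by rewrite (le_trans h1)// lerDl mulr_ge0// mulr_ge0.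
have : 2^-1 * 2^-1 ^+ (N + j) * (r / (1 + r)) <= 2^-1 * 2^-1 ^+ (N + j).
  by rewrite ler_piMr// mulr_ge0.
by move: h2; lra.
Qed.

Let martin_partial_homo x y :
  {homo (fun N => martin_partial N x y) : i j / (i <= j)%N >-> i <= j}.
Proof.
by move=> i j ij; have /andP[] := martin_partial_le x y i (j - i); rewrite subnKC.
Qed.

Lemma martin_partial_cvg x y :
  martin_partial N x y @[N --> \oo] --> martin_metric m D g phi x y.
Proof.
apply: (nondecreasing_is_cvgn (@martin_partial_homo x y)).
exists (martin_partial 0 x y + 1) => _ [N _ <-].
have /andP[_] := martin_partial_le x y 0 N; rewrite add0n expr0.
by move=> /le_trans; apply; rewrite gerBl exprn_ge0.
Qed.

(** Uniformly in x and y, the series of the Martin metric is 2^-N close to its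
    N-th partial sum. *)
Lemma martin_metric_le x y N :
  martin_metric m D g phi x y <= martin_partial N x y + 2^-1 ^+ N.
Proof.
apply: limr_le; first exact: cvgP (@martin_partial_cvg x y).
exists N => // j /= Nj; have /andP[_] := martin_partial_le x y N (j - N).
by rewrite subnKC// => /le_trans; apply; rewrite gerBl exprn_ge0.
Qed.

Lemma martin_metric_near0 x e : D x -> 0 < e ->
  \forall y \near x, martin_metric m D g phi x y < e.
Proof.
move=> Dx e0.
have [N Ne] : exists N, 2^-1 ^+ N < e / 2 :> R.
  have : 2^-1 ^+ N @[N --> \oo] --> (0 : R).
    by apply: cvg_expr; rewrite ger0_norm// invf_lt1// ltr1n.
  move=> /cvgrPdist_lt/(_ (e / 2)); rewrite divr_gt0// => /(_ isT)[N _ /(_ N (leqnn N))].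
  by rewrite /= sub0r normrN ger0_norm ?exprn_ge0// => ?; exists N.
have : martin_partial N x y @[y --> x] --> (0 : R).
  rewrite (_ : 0 = martin_partial N x x); last first.
    rewrite /martin_partial /series/= big1// => k _.
    by rewrite subrr normr0 mul0r mulr0.
  have : forall k, kappa_hat m D g (phi k) y @[y --> x] --> kappa_hat m D g (phi k) x.
    by move=> k; exact: kappa_hat_cvg.
  move: (nbhs x) (nbhs_filter x) => G GF kG.
  apply: cvg_big => [|k _]; first exact: add_continuous.
  apply: cvgM; first exact: cvg_cst.
  have kB := @cvgB _ _ _ G GF _ _ _ _ (@cvg_cst _ (kappa_hat m D g (phi k) x) _ G GF) (kG k).
  exact: (cvg_comp _ _ kB (@continuous_frac _)).
move=> /cvgrPdist_lt/(_ (e / 2)); rewrite divr_gt0// => /(_ isT).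
apply: filterS => y; rewrite sub0r normrN => /(le_lt_trans (ler_norm _)) h.
apply: (le_lt_trans (martin_metric_le x y N)).
by rewrite (splitr e) ltrD.
Qed.

(** Only compositions with functions on the sample space are considered, which
    avoids Borel sets of the product of the completion with itself. *)
Lemma measurable_martin_metric (E : set Omega) (Y Z : Omega -> 'rV[R]_n.+1) :
  measurable E -> measurable_fun E Y -> measurable_fun E Z ->
  Y @` E `<=` D -> Z @` E `<=` D ->
  measurable_fun E (fun w => martin_metric m D g phi (Y w) (Z w)).
Proof.
move=> mE mY mZ YD ZD.
have mk k W : measurable_fun E W -> W @` E `<=` D ->
    measurable_fun E (kappa_hat m D g (phi k) \o W).
  by move=> mW WD; apply: (measurable_comp mD WD) mW; exact: kappa_hat_measurable.
apply: (@measurable_fun_cvg _ _ _ _ (fun N w => martin_partial N (Y w) (Z w))); last first.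
  by move=> w _; exact: martin_partial_cvg.
move=> N; apply: measurable_sum => k; apply: measurable_funM => //.
have mf := continuous_measurable_fun continuous_frac.
apply: (measurableT_comp mf (measurable_funB (mk k Y mY YD) (mk k Z mZ ZD))).
Qed.


Context {Dstar : completePMetricType R}.
Variable iota : 'rV[R]_n.+1 -> Dstar.
Hypothesis iota_isometry : forall x y, D x -> D y ->
  mdist (iota x) (iota y) = martin_metric m D g phi x y.

Lemma completion_cvg x : D x -> iota y @[y --> x] --> iota x.
Proof.
move=> Dx.
have xD : nbhs x D by exact: open_nbhs_nbhs.
have : forall e, 0 < e -> \forall y \near nbhs x, martin_metric m D g phi x y < e.
  by move=> e; exact: martin_metric_near0.
move: (nbhs x) (nbhs_filter x) xD => G GF GD Ge.
apply/metricType_numDomainType.cvgrPdist_lt => e /Ge.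
by apply: filterS2 GD => y Dy; rewrite iota_isometry.
Qed.

Lemma completion_continuous : {within D, continuous iota}.
Proof. by apply: continuous_in_subspaceT => x /set_mem; exact: completion_cvg. Qed.

Hypothesis D_bounded : bounded_set D.

(** D is a countable union of compact sets, hence so is its image. *)
Lemma measurable_martin_boundary : measurable (martin_boundary D iota).
Proof.
apply: measurableC; rewrite -(bigcup_inner D_open) image_bigcup.
apply: bigcupT_measurable => k.
have cK : compact (inner D k).
  apply: bounded_closed_compact; last exact: closed_inner.
  have [M [Mr DM]] := D_bounded; exists M; split => // M' /DM DM' x.
  by move=> /inner_sub; exact: DM'.
have cI : closed (iota @` inner D k).
  apply: compact_closed; first exact: metric_hausdorff.
  apply: continuous_compact cK; apply: continuous_subspaceW completion_continuous.
  exact: inner_sub.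
rewrite -[X in measurable X]setCK; apply: measurableC.
by apply: sub_sigma_algebra; exact: closed_openC.
Qed.


Local Notation tau := (exit_time X D).

(** Parametrizing the paths by the fraction of their lifetime makes the
    approach to the exit time a limit along the same fractions for all paths,
    hence along countably many of them. *)
Definition at_fraction (q : R) w := X (Num.max 0 (q * fine (tau w))) w.

Let exits_later := [set w | (0 < tau w < +oo)%E].

Let measurable_exits_later : measurable exits_later.
Proof.
have mt := measurable_exit_time X_cont X_meas D_open.
rewrite (_ : exits_later = [set w | 0 < tau w]%E `&` [set w | tau w < +oo]%E).
  by apply: measurableI; rewrite -[X in measurable X]setTI; exact: measurable_lte.
apply/seteqP; split => w; rewrite /exits_later/=; first by move=> /andP.
by move=> [-> ->].
Qed.

Lemma measurable_at_fraction q : measurable_fun setT (at_fraction q).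
Proof.
have mt := measurable_exit_time X_cont X_meas D_open.
have mq : measurable_fun setT (fun w => (q * fine (tau w), w)).
  apply: measurable_fun_pair => //; apply: measurable_funM => //.
  exact: measurableT_comp mt.
exact: (measurableT_comp (jointly_measurable X_cont X_meas) mq).
Qed.

Let fine_exit_gt0 w : exits_later w -> (0 < fine (tau w))%R.
Proof. by move=> h; exact: fine_gt0. Qed.

Let exit_fin w : exits_later w -> tau w = (fine (tau w))%:E.
Proof. by move=> /andP[h1 h2]; rewrite fineK// gt0_fin_numE. Qed.

Lemma at_fraction_in q w : exits_later w -> 0 < q < 1 -> D (at_fraction q w).
Proof.
move=> Ew /andP[q0 q1]; have T0 := fine_exit_gt0 Ew.
have h : ((fine (tau w))%:E <= tau w)%E by rewrite -exit_fin.
apply: (proj1 (le_exit_time _ _ _ _) h).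
rewrite max_r; last by rewrite mulr_ge0// ltW.
by rewrite mulr_gt0//= gtr_pMl.
Qed.

Lemma exit_filterP w U : exits_later w ->
  exit_filter D iota X w U <->
  exists k : nat, forall q, 1 - k.+1%:R^-1 < q < 1 -> U (iota (at_fraction q w)).
Proof.
move=> Ew; have T0 := fine_exit_gt0 Ew; have TE := exit_fin Ew.
have bE t : before_exit X D w t <-> 0 <= t < fine (tau w).
  by rewrite /before_exit/= {1}TE lte_fin; split => [[-> ->]//|/andP[]].
rewrite /exit_filter /= /nbhs/= /within/=; split.
  move=> [e /= e0 eU]; have [k ke] : exists k : nat, k.+1%:R^-1 < e / fine (tau w).
    exists (Num.truncn (e / fine (tau w))^-1).
    by rewrite invf_plt ?posrE ?divr_gt0// truncnS_gt.
  have k1 : k.+1%:R^-1 <= 1 :> R by rewrite invf_le1// ler1n.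
  exists k => q /andP[kq q1].
  have q0 : 0 < q by rewrite (le_lt_trans _ kq)// subr_ge0.
  rewrite /at_fraction max_r; last by rewrite mulr_ge0// ltW.
  apply: eU => /=; last by apply/bE; rewrite mulr_ge0 ?ltW//= gtr_pMl.
  rewrite -{1}[fine (tau w)]mul1r -mulrBl normrM (gtr0_norm T0) gtr0_norm ?subr_gt0//.
  by rewrite -ltr_pdivlMr// (lt_trans _ ke)// ltrBlDr -ltrBlDl.
move=> [k kU]; exists (k.+1%:R^-1 * fine (tau w)); first by rewrite /= mulr_gt0.
move=> t /= tT /bE/andP[t0 t1].
have := kU (t / fine (tau w)); rewrite /at_fraction divfK ?gt_eqF// max_r//; apply.
rewrite ltr_pdivrMr// mul1r t1 andbT ltr_pdivlMr// mulrBl mul1r ltrBlDr -ltrBlDl.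
by apply: le_lt_trans tT; exact: ler_norm.
Qed.

Let frac k : R := 1 - k.+2%:R^-1.

Let fracP k j : (k <= j)%N -> 1 - k.+1%:R^-1 < frac j < 1.
Proof.
move=> kj; rewrite /frac ltrD2l ltrN2 ltf_pV2 ?posrE// ltr_nat ltnS.
by rewrite ltnS kj ltrBlDr ltrDl invr_gt0 ltr0n.
Qed.

Let frac_in k : 0 < frac k < 1.
Proof. by have := fracP (leq0n k); rewrite invr1 subrr. Qed.

Let exit_filter_proper w : exits_later w -> ProperFilter (exit_filter D iota X w).
Proof.
move=> Ew; apply: Build_ProperFilter_ex.
move=> U /(exit_filterP _ Ew)[k kU]; exists (iota (at_fraction (frac k) w)).
exact: kU (fracP (leqnn k)).
Qed.

(** By continuity of the paths, the Cauchy condition at the exit time need only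
    be tested along the sequence [frac] and the dyadic fractions. *)
Lemma exit_cvgP w : exits_later w ->
  cvg (exit_filter D iota X w) <->
  forall j : nat, exists k : nat, forall i N : nat,
    1 - k.+1%:R^-1 < (i%:R / 2 ^+ N : R) < 1 ->
    martin_metric m D g phi (at_fraction (frac k) w)
      (at_fraction (i%:R / 2 ^+ N) w) <= j.+1%:R^-1.
Proof.
move=> Ew; have PF := exit_filter_proper Ew; split.
  move=> /cvg_ex[l Fl] j.
  have /Fl/(exit_filterP _ Ew)[k kl] : nbhs l (ball l (j.+1%:R^-1 / 2)).
    by apply: nbhsx_ballx; rewrite divr_gt0.
  exists k => i N iN.
  have k1 : k.+1%:R^-1 <= 1 :> R by rewrite invf_le1// ler1n.
  have iN01 : 0 < (i%:R / 2 ^+ N : R) < 1.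
    by case/andP: iN => h ->; rewrite andbT (le_lt_trans _ h)// subr_ge0.
  have Dk := at_fraction_in Ew (frac_in k); have DN := at_fraction_in Ew iN01.
  rewrite -iota_isometry//; apply/ltW.
  have := ball_splitr (kl _ (fracP (leqnn k))) (kl _ iN).
  by rewrite ballEmdist.
move=> h; apply: cauchy_cvg; apply: cauchy_exP => e e0.
have [j je] : exists j : nat, j.+1%:R^-1 < e / 2.
  by exists (Num.truncn (e / 2)^-1); rewrite invf_plt ?posrE ?divr_gt0// truncnS_gt.
have [k hk] := h j; exists (iota (at_fraction (frac k) w)).
apply/(exit_filterP _ Ew); exists k => q /andP[kq q1].
have k1 : k.+1%:R^-1 <= 1 :> R by rewrite invf_le1// ler1n.
have q0 : 0 < q by rewrite (le_lt_trans _ kq)// subr_ge0.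
pose q_ N : R := (Num.truncn (2 ^+ N * q))%:R / 2 ^+ N.
have qq : q_ N @[N --> \oo] --> q by apply: dyadic_cvg; exact: ltW.
have T0 := fine_exit_gt0 Ew.
have Xq : at_fraction (q_ N) w @[N --> \oo] --> at_fraction q w.
  rewrite /at_fraction max_r; last by rewrite mulr_ge0// ltW.
  apply: (path_cvg_seq (@X_cont w)).
  - by rewrite mulr_ge0// ltW.
  - by move=> N; rewrite le_max lexx.
  rewrite (_ : (fun N => _) = fun N => q_ N * fine (tau w)).
    by apply: cvgM => //; exact: cvg_cst.
  apply/funext => N; rewrite max_r// mulr_ge0 ?(ltW T0)// divr_ge0// exprn_ge0//.
have Dq : D (at_fraction q w) by apply: at_fraction_in => //; rewrite q0.
have iq : iota (at_fraction (q_ N) w) @[N --> \oo] --> iota (at_fraction q w).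
  exact: (cvg_comp _ _ Xq (completion_cvg Dq)).
have e20 : 0 < e / 2 by rewrite divr_gt0.
have n1 : \forall N \near \oo,
    ball (iota (at_fraction q w)) (e / 2) (iota (at_fraction (q_ N) w)).
  exact: (iq _ (nbhsx_ballx _ _ e20)).
have n2 : \forall N \near \oo, 1 - k.+1%:R^-1 < q_ N < 1.
  apply: (qq [set t | 1 - k.+1%:R^-1 < t < 1]).
  have kq1 : q \in `]1 - k.+1%:R^-1, 1[ by rewrite in_itv/= kq.
  by apply: filterS (near_in_itvoo kq1) => t; rewrite /= in_itv.
have [N [h1 h2]] := @filter_ex _ (\oo : set_system nat) _ _ (filterI n1 n2).
apply: (@ball_splitl _ _ (iota (at_fraction (q_ N) w))).
  have Dk := at_fraction_in Ew (frac_in k).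
  have DN : D (at_fraction (q_ N) w).
    apply: at_fraction_in => //.
    by case/andP: h2 => h2 ->; rewrite andbT (le_lt_trans _ h2)// subr_ge0.
  rewrite ballEmdist/= iota_isometry//.
  exact: le_lt_trans (hk _ _ h2) je.
exact: h1.
Qed.


(** The event of which [harmonic_measure] takes the probability when the
    boundary set is the whole completion. *)
Definition exit_event :=
  [set w | (tau w < +oo)%E /\ cvg (exit_filter D iota X w)].

Let measurable_fraction_in (E : set Omega) q U : measurable E -> E `<=` exits_later ->
  0 < q < 1 -> open U -> measurable (E `&` (iota \o at_fraction q) @^-1` U).
Proof.
move=> mE EE q01 oU.
rewrite (_ : _ `&` _ = E `&` at_fraction q @^-1` (D `&` iota @^-1` U)); last first.
  apply/seteqP; split => w [Ew]; last by case.
  by split => //; split => //; exact: at_fraction_in (EE _ Ew) q01.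
apply: measurableI => //; rewrite -[X in measurable X]setTI.
apply: measurable_at_fraction => //; apply: open_measurable_rV.
exact: open_within_preimage completion_continuous oU.
Qed.

Let measurable_exits_cvg :
  measurable (exits_later `&` [set w | cvg (exit_filter D iota X w)]).
Proof.
rewrite (_ : _ `&` _ = \bigcap_(j in [set: nat]) \bigcup_(k in [set: nat])
    \bigcap_(i in [set: nat]) \bigcap_(N in [set: nat])
    (exits_later `&` [set w | 1 - k.+1%:R^-1 < (i%:R / 2 ^+ N : R) < 1 ->
      martin_metric m D g phi (at_fraction (frac k) w)
        (at_fraction (i%:R / 2 ^+ N) w) <= j.+1%:R^-1])); last first.
  apply/seteqP; split => w.
    move=> [Ew /(exit_cvgP Ew) h] j _; have [k hk] := h j.
    by exists k => // i _ N _; split => //; exact: hk.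
  move=> h; have Ew : exits_later w by have [k _ /(_ 0%N I 0%N I)[]] := h 0%N I.
  split => //; apply/(exit_cvgP Ew) => j; have [k _ hk] := h j I; exists k => i N.
  by have [_] := hk i I N I.
apply: bigcapT_measurable => j; apply: bigcupT_measurable => k.
apply: bigcapT_measurable => i; apply: bigcapT_measurable => N.
have [/andP[c1 c2]|nc] := boolP (1 - k.+1%:R^-1 < (i%:R / 2 ^+ N : R) < 1); last first.
  by rewrite (_ : [set w | _] = setT) ?setIT//; apply/seteqP; split.
have q01 : 0 < (i%:R / 2 ^+ N : R) < 1.
  by rewrite c2 andbT (le_lt_trans _ c1)// subr_ge0 invf_le1// ler1n.
have mm := @measurable_martin_metric exits_later (at_fraction (frac k))
  (at_fraction (i%:R / 2 ^+ N)) measurable_exits_later.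
rewrite (_ : _ `&` _ = exits_later `&` [set w | martin_metric m D g phi
    (at_fraction (frac k) w) (at_fraction (i%:R / 2 ^+ N) w) <= j.+1%:R^-1]); last first.
  by apply/seteqP; split => w [Ew h]; split => //; exact: (h isT).
have mf : measurable_fun exits_later (fun w => martin_metric m D g phi
    (at_fraction (frac k) w) (at_fraction (i%:R / 2 ^+ N) w)).
  apply: mm; [exact/measurable_funTS/measurable_at_fraction..| |];
    by move=> _ [w Ew <-]; exact: at_fraction_in.
have := mf measurable_exits_later _ (measurable_itv `]-oo, j.+1%:R^-1]).
by congr (measurable (_ `&` _)); apply/seteqP; split => w; rewrite /= in_itv.
Qed.

(** A path that leaves D at once has no time before its exit, and its exit filter
    contains every set. *)
Let exit_filter0 w : tau w = 0%E -> exit_filter D iota X w = setT.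
Proof.
move=> t0; apply/seteqP; split => // U _.
rewrite /exit_filter /= /nbhs/= /within/= /before_exit t0.
by exists 1 => //= t _ [t_ge0]; rewrite lte_fin ltNge t_ge0.
Qed.

Let exit_eventE : exit_event = [set w | tau w = 0%E] `|`
  (exits_later `&` [set w | cvg (exit_filter D iota X w)]).
Proof.
apply/seteqP; split => w.
  move=> [tw cw]; have := exit_time_ge0 X D w; rewrite le_eqVlt => /predU1P[t0|t0].
    by left.
  by right; split => //; rewrite /exits_later/= t0.
move=> [/= t0|[/andP[_ ?] ?]]; last by split.
rewrite /exit_event/=; split; first by rewrite t0.
by rewrite exit_filter0//; apply/cvg_ex; exists point.
Qed.

Let measurable_exits_now : measurable [set w | tau w = 0%E].
Proof.
rewrite -[X in measurable X]setTI.
have := measurable_exit_time X_cont X_meas D_open measurableT (emeasurable_set1 0%E).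
by congr (measurable (_ `&` _)).
Qed.

Lemma measurable_exit_event : measurable exit_event.
Proof. by rewrite exit_eventE; exact: measurableU. Qed.

Let at_fraction_cvg w : exits_later w -> cvg (exit_filter D iota X w) ->
  iota (at_fraction (frac k) w) @[k --> \oo] --> exit_position D iota X w.
Proof.
move=> Ew cw U /cw /(exit_filterP _ Ew)[k kU].
by exists k => // j /= kj; apply: kU; exact: fracP.
Qed.

(** On the paths with a positive lifetime the exit position is a limit of
    measurable maps; on the others it is constant, by [exit_filter0]. *)
Lemma measurable_exit_position : measurable_fun exit_event
  (exit_position D iota X : Omega -> borel Dstar).
Proof.
apply: measurable_fun_open_borel => U oU; rewrite exit_eventE setIUl.
apply: measurableU.
  have c w w' : tau w = 0%E -> tau w' = 0%E ->
      exit_position D iota X w = exit_position D iota X w'.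
    by move=> t t'; rewrite /exit_position !exit_filter0.
  have [[w0 [t0 U0]]|h] := pselect (exists w, tau w = 0%E /\ U (exit_position D iota X w)).
    rewrite (_ : _ `&` _ = [set w | tau w = 0%E])//.
    by apply/seteqP; split => [w []//|w /= t]; split => //=; rewrite (c _ w0).
  rewrite (_ : _ `&` _ = set0)//; apply/seteqP; split => // w [t Uw].
  by apply: h; exists w.
have E1 : exits_later `&` [set w | cvg (exit_filter D iota X w)] `<=` exits_later by move=> w [].
apply: (@measurable_preimage_lim _ Omega R Dstar _ (fun k => iota \o at_fraction (frac k)));
  last exact: oU.
- by move=> k V oV; exact: measurable_fraction_in.
- by move=> w [Ew cw]; exact: at_fraction_cvg.
Qed.


Local Open Scope ereal_scope.

(** Any value outside [exit_event] will do, as the laws below are restricted to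
    it. *)
Let exit_point w : borel Dstar :=
  if w \in exit_event then exit_position D iota X w else point.

Let measurable_exit_point : measurable_fun setT exit_point.
Proof.
move=> _ B mB; rewrite (_ : _ `&` _ =
    (exit_event `&` exit_position D iota X @^-1` B) `|`
    (~` exit_event `&` [set w | B point])); last first.
  rewrite setTI; apply/seteqP; split => w; rewrite /exit_point/=.
    by case: ifPn => [/set_mem|/negP nE] ?; [left|right; split => // /mem_set].
  by move=> [[Ew Bw]|[nE Bp]]; [rewrite mem_set|rewrite memNset].
apply: measurableU; first exact: measurable_exit_position measurable_exit_event _ mB.
apply: measurableI; first exact: measurableC measurable_exit_event.
have [Bp|nBp] := pselect (B point).
  by rewrite (_ : [set _ | _] = setT)//; apply/seteqP; split.
by rewrite (_ : [set _ | _] = set0)//; apply/seteqP; split.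
Qed.

Let exit_law (x : 'rV[R]_n.+1) : {measure set (borel Dstar) -> \bar R}.
Proof.
by refine (pushforward (mrestr (P x) measurable_exit_event) exit_point);
  exact: measurable_exit_point.
Defined.

Let harmonic_measureE x : harmonic_measure D iota X P x = exit_law x.
Proof.
apply/funext => B; rewrite /harmonic_measure /exit_law/= /pushforward /mrestr/=.
congr (P x _); apply/seteqP; split => w /=; rewrite /exit_point.
  by move=> [tw cw Bw]; rewrite mem_set.
by move=> [] + [tw cw]; rewrite mem_set.
Qed.

Let measurable_exit_law U : measurable U -> measurable_fun setT (exit_law ^~ U).
Proof.
move=> mU; apply: measurable_kernel; apply: measurableI measurable_exit_event.
rewrite -[X in measurable X]setTI; exact: measurable_exit_point.
Qed.

(** The harmonic measure of x is the law under P_x of the exit position on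
    [exit_event], and the one of m is the mixture of these laws, so Tonelli
    bounds the integral of the harmonic extension by that of [psi]. *)
Lemma integrable_harmonic_extension psi : L1_boundary D iota X P m psi ->
  m.-integrable D (EFin \o harmonic_extension D iota X P psi).
Proof.
move=> /integrableP[mpsi psi_lty].
have mB := measurable_martin_boundary.
pose psi0 := (EFin \o psi) \_ (martin_boundary D iota).
have mpsi0 : measurable_fun setT psi0 by apply/(measurable_restrictT _ mB).
have extE x : harmonic_extension D iota X P psi x = fine (\int[exit_law x]_z psi0 z).
  by rewrite /harmonic_extension harmonic_measureE integral_mkcond.
have mI f : measurable_fun setT f -> (forall z, 0 <= f z) ->
    measurable_fun D (fun x => \int[exit_law x]_z f z).
  move=> mf f0; apply: measurable_funTS.
  exact: (measurable_fun_integral_kernel (l := exit_law)).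
have mabs : measurable_fun setT (abse \o psi0) by exact: measurableT_comp mpsi0.
have ext_lty : \int[m]_(x in D) \int[exit_law x]_z `|psi0 z| < +oo.
  have <- := ge0_integral_mixture mD measurable_exit_law
    (nu := mixture m mD measurable_exit_law) (fun=> fun=> erefl) mabs
    (fun z => abse_ge0 (psi0 z)).
  have nuE : harmonic_measure_m D iota X P m = mixture m mD measurable_exit_law.
    by apply/funext => B; apply: eq_integral => x _; rewrite harmonic_measureE.
  rewrite nuE integral_mkcond in psi_lty; apply: le_lt_trans psi_lty.
  rewrite le_eqVlt; apply/orP; left; apply/eqP; apply: eq_integral => z _.
  by rewrite /psi0 /= !patchE; case: ifPn => // _; rewrite abse0.
apply: (@le_integrable _ _ _ m D mD _ (fun x => \int[exit_law x]_z `|psi0 z|)).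
- apply/measurable_EFinP; apply: (eq_measurable_fun (fun x =>
    fine (\int[exit_law x]_z psi0^\+ z - \int[exit_law x]_z psi0^\- z))).
    by move=> x _; rewrite extE [in RHS]integralE.
  apply: measurableT_comp => //; apply: emeasurable_funB; apply: mI => //.
  + exact: measurable_funepos.
  + exact: measurable_funeneg.
- move=> x _; rewrite /= extE [leRHS]gee0_abs ?integral_ge0//.
  apply: le_trans (le_abse_integral _ measurableT mpsi0).
  by case: (\int[exit_law x]_z psi0 z) => //=; rewrite ?normr0 leey.
apply/integrableP; split; first exact: mI.
by under eq_integral do rewrite gee0_abs ?integral_ge0//.
Qed.

End MartinMetric.

(** * Uniqueness *)

Theorem proposition8p4 (R : realType) (n : nat) (d_ge2 : (2 <= n.+1)%N)
  (m : {measure set 'rV[R]_n.+1 -> \bar R}) (m_leb : is_lebesgue_measure m)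
  (D : set 'rV[R]_n.+1) (D_open : open D) (D_bounded : bounded_set D)
  (a : 'rV[R]_n.+1 -> 'M[R]_n.+1) (a_ell : elliptic_coefficients a)
  (dO : measure_display) (Omega : measurableType dO)
  (X : R -> Omega -> 'rV[R]_n.+1) (P : R.-pker 'rV[R]_n.+1 ~> Omega)
  (F : R -> set (set Omega)) (X_diff : is_diffusion X P F m a)
  (g : 'rV[R]_n.+1 -> 'rV[R]_n.+1 -> \bar R)
  (g_green : is_green_function m D X P g)
  (phi : nat -> 'rV[R]_n.+1 -> R) (phi_dense : dense_in_C0 D phi)
  (Dstar : completePMetricType R) (iota : 'rV[R]_n.+1 -> Dstar)
  (Dstar_compl : is_completion D iota (martin_metric m D g phi))
  (mu : signed_measure D) (mu_Mdelta : Mdelta m g mu)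
  (psi : borel Dstar -> R) (psi_L1 : L1_boundary D iota X P m psi)
  (f : 'rV[R]_n.+1 -> R -> R)
  (f_meas : measurable_fun (D `*` setT)
              (fun p : 'rV[R]_n.+1 * R => f p.1 p.2))
  (f_cont : forall x, D x -> continuous (f x))
  (f_noninc : forall x, D x -> forall y z, y <= z -> f x z <= f x y)
  (f_qL1 : forall y, qL1 X P D m a (fun x => f x y))
  (f0_L1delta : L1delta m D g (fun x => f x 0)) :
  forall u v : 'rV[R]_n.+1 -> R,
    is_solution iota X P m g f mu psi u ->
    is_solution iota X P m g f mu psi v ->
    u = v %[ae m in D].
Proof.
move=> u v [iu [mfu ifu] Hu] [iv [mfv ifv] Hv].
have F_filtration := diffusion_filtration X_diff.
have X_adapted := diffusion_adapted X_diff.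
have X_start := diffusion_start X_diff.
have X_cont := diffusion_continuous X_diff.
have X_meas := process_measurable F_filtration X_adapted.
have mD : measurable D := open_measurable_rV D_open.
have phi_bounded k := C0_bounded_borel D_open (phi_dense.1 k).
have iext := integrable_harmonic_extension X_meas X_start X_cont D_open g_green
  phi_bounded (completion_isometry Dstar_compl) D_bounded psi_L1.
(* The left-hand sides of the two identities can be subtracted. *)
have sub_indic (w : 'rV[R]_n.+1 -> R) B : measurable B -> m.-integrable D (EFin \o w) ->
    m.-integrable D (EFin \o
      (fun x => (w x - harmonic_extension D iota X P psi x) * \1_B x)).
  move=> mB iw; have iwe := integrableB mD iw iext.
  apply: (le_integrable mD _ _ iwe).
    apply/measurable_EFinP; apply: measurable_funM; last exact: measurable_indic.
    by apply/measurable_EFinP; exact: (measurable_int _ iwe).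
  move=> x Dx; rewrite /= lee_fin normrM ler_piMr// indicE.
  by case: (_ \in _); rewrite ?normr1 ?normr0.
suff : {ae m, forall x, D x -> u x - v x = 0}.
  by apply: filterS => x h Dx; apply/eqP; rewrite -subr_eq0 h.
apply: (very_weak_solution_eq0 F_filtration X_adapted X_start X_cont
  (diffusion_markov X_diff) D_open (lebesgue_bounded_lty m_leb D_open D_bounded)
  g_green (h := fun x => f x (u x) - f x (v x))).
- exact: (integrableB mD iu iv).
- exact: measurable_funB.
- under eq_fun do rewrite mulrBl EFinB.
  exact: (integrableB mD ifu ifv).
- move=> B mB BD.
  have bB : bounded_borel D (\1_B : 'rV[R]_n.+1 -> R).
    split; first exact: measurable_indic.
    by exists 1 => x _; rewrite indicE; case: (_ \in _); rewrite ?normr1 ?normr0.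
  transitivity (
      \int[m]_(x in D) ((u x - harmonic_extension D iota X P psi x) * \1_B x) -
      \int[m]_(x in D) ((v x - harmonic_extension D iota X P psi x) * \1_B x)).
    rewrite -RintegralB//; [|exact: sub_indic..].
    by apply: eq_Rintegral => x _; rewrite -mulrBl opprB addrA subrK.
  have igu := integrable_green_indic D_open g_green mB mfu ifu.
  have igv := integrable_green_indic D_open g_green mB mfv ifv.
  rewrite (Hu _ bB) (Hv _ bB) opprD addrACA subrr addr0 -(RintegralB mD igu igv).
  by apply: eq_Rintegral => x _; rewrite mulrBl.
- move=> x Dx; rewrite subr_gt0 subr_le0 => fvu; rewrite leNgt; apply/negP => /ltW vu.
  by have := f_noninc x Dx _ _ vu; rewrite leNgt fvu.
- move=> x Dx; rewrite subr_lt0 subr_ge0 => fuv; rewrite leNgt; apply/negP => /ltW uv.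
  by have := f_noninc x Dx _ _ uv; rewrite leNgt fuv.
Qed.
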